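(* Consider the fast-slow system $x'=f(x,y)$, $y'=\frac1\varepsilon g(x,y)$, $(x(0),y(0))=(x_0,y_0)$, with $0<\varepsilon\le\varepsilon_0\ll1$, satisfying the regularity assumption (with integer $K>0$), the rapid dissipation assumption, the long-time stability assumption and the mild growth assumption described in the context. Let $0\le k\le K-1$ be an integer, and let $X_k$ solve the $k$-th order correction model $X_k'=f(X_k,\Gamma_k(X_k,\varepsilon))$ with $X_k(0)=x(0)$, and suppose that $|y(0)-\Gamma_k(x(0),\varepsilon)|=\mathcal O(\varepsilon^{k+1})$ (i.e. it is at most a constant independent of $\varepsilon$ times $\varepsilon^{k+1}$). Then there exists a constant $C>0$ independent of $\varepsilon$ and $t$ such that $$|x(t)-X_k(t)|\le C\varepsilon^{k+1}\zeta_k(\varepsilon,t),\qquad \zeta_k(\varepsilon,t)=\int_0^t e^{\lambda_k(\varepsilon)s}\,\mathrm ds ,\qquad t\ge 0.$$ Furthermore, the maximal stability time $T_\varepsilon$ of the $k$-th order model is determined by $\lambda_k(\varepsilon)$: $T_\varepsilon\sim\lambda_k(\varepsilon)^{-1}$ if $\lambda_k(\varepsilon)>0$, and $T_\varepsilon=\infty$ if $\lambda_k(\varepsilon)\le0$, in the sense that the flow of the $k$-th order model is Lipschitz with respect to its initial value, with a constant independent of $\varepsilon$ and $t$, for all $t\in[0,T_\varepsilon]$ (all $t\in[0,\infty)$ if $T_\varepsilon=\infty$). The factor $\zeta_k$ behaves as follows, where $\lesssim$ denotes inequality up to a positive constant independent of $\varepsilon$ and $t$: (i) if $\lambda_k(\varepsilon)\lesssim\varepsilon^m$,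 then $\zeta_k(\varepsilon,t)\lesssim t$ for $t$ up to a time $T_\varepsilon\sim\varepsilon^{-m}$; (ii) if $\lambda_k(\varepsilon)\le0$, then $\zeta_k(\varepsilon,t)\le t$ for all $t\ge0$ ($T_\varepsilon=\infty$); (iii) if $\lambda_k(\varepsilon)\lesssim-\varepsilon^m$ (i.e. $\lambda_k(\varepsilon)\le-c\,\varepsilon^m$ with $c>0$ independent of $\varepsilon$), then $\zeta_k(\varepsilon,t)\lesssim\min\{t,\varepsilon^{-m}\}$ for all $t\ge0$ ($T_\varepsilon=\infty$).
   Context: Setting. $x(t)\in\mathbb R^{n_x}$ and $y(t)\in\mathbb R^{n_y}$ are the slow and fast variables of the system $x'=f(x,y)$, $y'=\frac1\varepsilon g(x,y)$, $x(0)=x_0$, $y(0)=y_0$, where $0<\varepsilon\le\varepsilon_0\ll 1$; the functions $f,g$ do not depend on $\varepsilon$. Regularity assumption: $f,g$ are sufficiently smooth, and for some integer $K>0$, $f\in W^{K,\infty}(\mathbb R^{n_x}\times\mathbb R^{n_y},\mathbb R^{n_x})$ and $\nabla g\in W^{K,\infty}(\mathbb R^{n_x}\times\mathbb R^{n_y},\mathbb R^{n_y\times(n_x+n_y)})$. Rapid dissipation assumption: there is $\beta>0$ such that $\langle g(x,y)-g(x,\tilde y),y-\tilde y\rangle\le-\beta|y-\tilde y|^2$ for all $x\in\mathbb R^{n_x}$, $y,\tilde y\in\mathbb R^{n_y}$. Under these assumptions $g(x,\cdot):\mathbb R^{n_y}\to\mathbb R^{n_y}$ is bijective for each $x$; $\gamma(x)$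 denotes the unique point with $g(x,\gamma(x))=0$. Long-time stability assumption: the flow map $\Phi_t^\varepsilon(x_0,y_0)=(x(t),y(t))$ of the full system satisfies $\|\nabla\Phi_t^\varepsilon\|_{L^\infty}\le A$ for all $t$ up to the time scale of interest (the maximal stability time of the full system), with $A>0$ independent of $\varepsilon$ and $t$. Correction models: $\Gamma_0(x,\varepsilon)=\gamma(x)$, and $\Gamma_{k+1}(x,\varepsilon)$ is defined recursively as the unique solution of $g(x,\Gamma_{k+1}(x,\varepsilon))=\varepsilon\,\nabla_x\Gamma_k(x,\varepsilon)\cdot f(x,\Gamma_k(x,\varepsilon))$. The $k$-th order correction model is $X_k'=F_k(X_k)$ with $F_k(x)=f(x,\Gamma_k(x,\varepsilon))$. Its one-sided Lipschitz constant is $$\lambda_k(\varepsilon)=\sup_{x,\tilde x\in\mathbb R^{n_x},\,x\ne\tilde x}\frac{\langle F_k(x)-F_k(\tilde x),x-\tilde x\rangle}{|x-\tilde x|^2}.$$ Mild growth assumption: for the reduced vector field $F_0(x)=f(x,\gamma(x))$, one has $\lambda_0=\sup_{x\ne\tilde x}\frac{\langle F_0(x)-F_0(\tilde x),x-\tilde x\rangle}{|x-\tilde x|^2}\le0$. $T_\varepsilon\sim a_\varepsilon$ means that $T_\varepsilon$ is bounded above and below by positive constants, independent of $\varepsilon$, times $a_\varepsilon$. In the theorem $T_\varepsilon$ is the stability horizon guaranteed by $\lambda_k(\varepsilon)$, i.e. $T_\varepsilon$ is a fixed positive constant times $\lambda_k(\varepsilon)^{-1}$ if $\lambda_k(\varepsilon)>0$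 (or a fixed positive constant times $\varepsilon^{-m}$ in case (i)), and $\infty$ otherwise. *)

(* Defs.v *)
From HB Require Import structures.
From mathcomp Require Import all_boot all_order all_algebra.
From mathcomp Require Import all_classical all_reals all_analysis.

Set Implicit Arguments.
Unset Strict Implicit.
Unset Printing Implicit Defensive.

Import Order.TTheory GRing.Theory Num.Theory.
Import numFieldNormedType.Exports.

Local Open Scope classical_set_scope.
Local Open Scope ring_scope.

(* The library norm `|u| on 'rV[R]_n is the sup norm, so the Euclidean inner
   product and norm of the estimates are introduced here. *)
Definition dot {R : realType} {n : nat} (u v : 'rV[R]_n) : R :=
  \sum_i u 0 i * v 0 i.

Definition enorm {R : realType} {n : nat} (u : 'rV[R]_n) : R :=
  Num.sqrt (dot u u).

(* h is of class C^k and lies in W^{k,oo}: all derivatives of order at most k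
   exist, are continuous and are bounded.  For such h the weak derivatives are
   the classical ones and the essential suprema are suprema.  Iterating over
   all directions v is the same as iterating over the coordinate directions. *)
Fixpoint smooth_bounded {R : realType} {V W : normedModType R} (k : nat)
    (h : V -> W) : Prop :=
  continuous h /\ (exists M : R, forall z, `|h z| <= M) /\
  match k with
  | 0%N => True
  | j.+1 => (forall z, differentiable h z) /\
            (forall v : V, smooth_bounded j (fun z => 'D_v h z))
  end.

(* X solves X' = F(X) on [0, +oo[; at t = 0 only continuity is required, the
   one-sided derivative there follows from the equation for t > 0. *)
Definition solves {R : realType} {V : normedModType R} (F : V -> V)
    (X : R -> V) : Prop :=
  {within `[0, +oo[, continuous X} /\
  (forall t : R, 0 < t -> is_derive t (1 : R) X (F (X t))).

Definition is_flow {R : realType} {V : normedModType R} (F : V -> V)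
    (Phi : R -> V -> V) : Prop :=
  forall z, solves F (fun t => Phi t z) /\ Phi 0 z = z.

(* The time-t flow map of X' = F(X) is L-Lipschitz in the initial value. *)
Definition lipschitz_flow_at {R : realType} {n : nat}
    (F : 'rV[R]_n -> 'rV[R]_n) (L t : R) : Prop :=
  forall X1 X2 : R -> 'rV[R]_n, solves F X1 -> solves F X2 ->
    enorm (X1 t - X2 t) <= L * enorm (X1 0 - X2 0).

Section FastSlow.
Context {R : realType} {nx ny : nat}.
Local Notation vx := ('rV[R]_nx).
Local Notation vy := ('rV[R]_ny).
Variables (f : vx * vy -> vx) (g : vx * vy -> vy).

Definition fast_slow (eps : R) (z : vx * vy) : vx * vy :=
  (f z, eps^-1 *: g z).

(* The y with g(x, y) = v, which exists and is unique when g(x, .) is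
   bijective; an arbitrary vector otherwise. *)
Definition solve_fast (x : vx) (v : vy) : vy := get [set y | g (x, y) = v].

Definition gamma (x : vx) : vy := solve_fast x 0.

Fixpoint Gamma (k : nat) (eps : R) (x : vx) : vy :=
  match k with
  | 0%N => gamma x
  | j.+1 => solve_fast x
      (eps *: 'd (Gamma j eps) x (f (x, Gamma j eps x)))
  end.

Definition corrected_field (k : nat) (eps : R) (x : vx) : vx :=
  f (x, Gamma k eps x).

End FastSlow.

(* This is a real supremum: it has its usual meaning as soon as F is Lipschitz
   and n > 0 (for n = 0 the set is empty and the value is 0). *)
Definition one_sided_lipschitz {R : realType} {n : nat}
    (F : 'rV[R]_n -> 'rV[R]_n) : R :=
  sup [set q | exists x x', x != x' /\
                 q = dot (F x - F x') (x - x') / enorm (x - x') ^+ 2].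

Definition zeta {R : realType} (lam t : R) : R :=
  \int[lebesgue_measure]_(s in `[0, t]) expR (lam * s).

Definition stability_horizon {R : realType} (c lam : R) : \bar R :=
  if 0 < lam then (c / lam)%:E else +oo%E.

(* Main.v *)
(* With z = y - Gamma_k(x), the defining relation g(x, Gamma_k) = eps r_k, where
   r_{k+1} = D Gamma_k . f(x, Gamma_k), gives
     z' = (g(x, y) - g(x, Gamma_k)) / eps - (r_{k+1} - r_k)
          - D Gamma_k . (f(x, y) - f(x, Gamma_k)).
   Dissipativity makes the first term contract z at rate beta / eps, so |z| stays
   O(eps^{k+1}) for all times as soon as r_{k+1} - r_k = O(eps^k).  That rate is
   proved by induction on k together with W^{K-k,oo} bounds uniform in eps: the
   derivatives of Gamma_k solve linear systems with the uniformly coercive matrix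
   D_y g, and one derivative is lost at each step of the recursion.  Gronwall's
   inequality for |x - X_k| with one-sided Lipschitz constant lambda_k and forcing
   O(eps^{k+1}) then yields the error estimate. *)
From HB Require Import structures.
From mathcomp Require Import all_boot all_order all_algebra.
From mathcomp Require Import all_classical all_reals all_analysis.
From mathcomp Require Import ring lra.
Require Import Defs.

Set Implicit Arguments.
Unset Strict Implicit.
Unset Printing Implicit Defensive.

Import Order.TTheory GRing.Theory Num.Theory.
Import numFieldNormedType.Exports.
Local Open Scope classical_set_scope.
Local Open Scope ring_scope.

(** * Euclidean geometry of row vectors *)

(** All bounds must be uniform in [eps] for an arbitrary [eps0]. The hierarchy is therefore carried
    as families of functions indexed by the admissible parameters, and a rate [O(eps^k)] in
    [W^{m,oo}] is read as boundedness of the family rescaled by [eps ^- k]. Bounds and rates then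
    obey the same calculus of sums, products, compositions and linear systems. Only the gradient of
    [g] is bounded, so the values of [Gamma_k] need not be: for them only derivatives are bounded.
    Derivatives are measured in the sup norm and dissipation in the Euclidean norm. Passing from one
    to the other costs a dimension factor, harmless in a constant but not in a contraction, so decay
    is always measured in the Euclidean norm. No inverse matrix is formed: the coercivity inequality
    itself gives injectivity, surjectivity and the bound on the solution. Differentiability of
    [Gamma_k] comes from an implicit function theorem that asks [g] to be differentiable at the
    single point considered, because dissipation is global. *)

Section Euclidean.
Context {R : realType} {n : nat}.
Implicit Types u v w : 'rV[R]_n.

Lemma dotC u v : dot u v = dot v u.
Proof. by apply: eq_bigr => i _; rewrite mulrC. Qed.

Lemma dotDl u v w : dot (u + v) w = dot u w + dot v w.
Proof. by rewrite -big_split; apply: eq_bigr => i _; rewrite mxE mulrDl. Qed.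

Lemma dotZl a u v : dot (a *: u) v = a * dot u v.
Proof. by rewrite mulr_sumr; apply: eq_bigr => i _; rewrite mxE mulrA. Qed.

Lemma dotNl u v : dot (- u) v = - dot u v.
Proof. by rewrite -scaleN1r dotZl mulN1r. Qed.

Lemma dotBl u v w : dot (u - v) w = dot u w - dot v w.
Proof. by rewrite dotDl dotNl. Qed.

Lemma dotDr u v w : dot w (u + v) = dot w u + dot w v.
Proof. by rewrite dotC dotDl !(dotC w). Qed.

Lemma dotZr a u v : dot v (a *: u) = a * dot v u.
Proof. by rewrite dotC dotZl dotC. Qed.

Lemma dotBr u v w : dot w (u - v) = dot w u - dot w v.
Proof. by rewrite dotC dotBl !(dotC w). Qed.

Lemma dot0l u : dot 0 u = 0.
Proof. by rewrite -(scale0r u) dotZl mul0r. Qed.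

Lemma dot_ge0 u : 0 <= dot u u.
Proof. by apply: sumr_ge0 => i _; rewrite -expr2 sqr_ge0. Qed.

Lemma enorm_ge0 u : 0 <= enorm u.
Proof. exact: sqrtr_ge0. Qed.

Lemma sqr_enorm u : enorm u ^+ 2 = dot u u.
Proof. by rewrite sqr_sqrtr// dot_ge0. Qed.

Lemma sqr_enormD u v :
  enorm (u + v) ^+ 2 = enorm u ^+ 2 + 2 * dot u v + enorm v ^+ 2.
Proof. rewrite !sqr_enorm dotDl !dotDr (dotC v u); ring. Qed.

Lemma enorm0 : enorm (0 : 'rV[R]_n) = 0.
Proof. by rewrite /enorm dot0l sqrtr0. Qed.

Lemma enorm_eq0 u : enorm u = 0 -> u = 0.
Proof.
move=> u0; have: dot u u = 0 by rewrite -sqr_enorm u0 expr0n.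
move/eqP; rewrite psumr_eq0 => [/allP u0'|i _]; last by rewrite -expr2 sqr_ge0.
apply/rowP => i; rewrite mxE.
by have /(_ (mem_index_enum i)) := u0' i; rewrite mulf_eq0 orbb => /eqP.
Qed.

Lemma enormZ a u : enorm (a *: u) = `|a| * enorm u.
Proof. by rewrite /enorm dotZl dotZr mulrA -expr2 sqrtrM ?sqr_ge0// sqrtr_sqr. Qed.

Lemma enormN u : enorm (- u) = enorm u.
Proof. by rewrite -scaleN1r enormZ normrN1 mul1r. Qed.

(** Cauchy-Schwarz: expand the square of [enorm v *: u - enorm u *: v] and cancel the factor
    [enorm u * enorm v], whence the separate treatment of zero vectors. *)
Lemma dot_le_enorm u v : dot u v <= enorm u * enorm v.
Proof.
have [u0|u0] := eqVneq (enorm u) 0.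
  by rewrite u0 (enorm_eq0 u0) dot0l mul0r.
have [v0|v0] := eqVneq (enorm v) 0.
  by rewrite v0 (enorm_eq0 v0) dotC dot0l mulr0.
have u_gt0 : 0 < enorm u by rewrite lt_neqAle eq_sym u0 enorm_ge0.
have v_gt0 : 0 < enorm v by rewrite lt_neqAle eq_sym v0 enorm_ge0.
have := dot_ge0 (enorm v *: u - enorm u *: v).
rewrite dotBl !dotBr !dotZl !dotZr -!sqr_enorm (dotC v u) => h.
have uv_gt0 : 0 < enorm u * enorm v by rewrite mulr_gt0.
rewrite -(ler_pM2l uv_gt0).
by nra.
Qed.

Lemma norm_dot_le u v : `|dot u v| <= enorm u * enorm v.
Proof.
rewrite ler_norml dot_le_enorm andbT lerNl -dotNl.
by rewrite -(enormN u) dot_le_enorm.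
Qed.

Lemma norm_le_enorm u : `|u| <= enorm u.
Proof.
rewrite [leLHS]mx_normrE; apply/bigmax_leP; split=> [|[i j] _ /=].
  exact: enorm_ge0.
rewrite -sqrtr_sqr ler_wsqrtr// ord1 /dot (bigD1 j)//= -expr2 lerDl.
by apply: sumr_ge0 => l _; rewrite -expr2 sqr_ge0.
Qed.

Lemma coord_le_norm u i : `|u 0 i| <= `|u|.
Proof.
by rewrite [leRHS]mx_normrE; apply: (le_bigmax _ (fun i => `|u i.1 i.2|) (0, i)).
Qed.

(** The crude factor [n], instead of its square root, is enough: it only enters constants
    independent of [eps]. *)
Lemma enorm_le_norm u : enorm u <= n%:R * `|u|.
Proof.
rewrite -(@ler_pXn2r _ 2)// ?nnegrE ?mulr_ge0 ?enorm_ge0//.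
rewrite sqr_enorm exprMn.
apply: (@le_trans _ _ (n%:R * `|u| ^+ 2)); last first.
  rewrite ler_wpM2r ?sqr_ge0// -natrX ler_nat.
  by case: (n) => // m; rewrite expnS leq_pmulr// expn_gt0.
rewrite mulr_natl -[in X in _ *+ X](card_ord n) -sumr_const.
apply: ler_sum => i _; rewrite -expr2 -(real_normK (num_real (u 0 i))).
by rewrite ler_pXn2r ?nnegrE// coord_le_norm.
Qed.

End Euclidean.

(** * Strongly monotone maps *)

(* Richardson iteration: [y + tau (G y - v)] contracts the Euclidean norm for
   [tau = b / L^2]; an iterate of it contracts the sup norm. *)
Lemma strongly_monotone_surj {R : realType} {n : nat}
    (G : 'rV[R]_n -> 'rV[R]_n) (b L : R) :
  0 < b ->
  (forall y y', dot (G y - G y') (y - y') <= - b * enorm (y - y') ^+ 2) ->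
  (forall y y', enorm (G y - G y') <= L * enorm (y - y')) ->
  forall v, exists y, G y = v.
Proof.
move=> b_gt0 Gmono Glip v.
(* In dimension 0 nothing forces [b <= L], nor even [0 <= L]; the enlarged constant [M] keeps the
   squared contraction factor [q2] in [[0, 1[]. *)
pose M : R := `|L| + b.
have M_gt0 : 0 < M by rewrite ltr_wpDl.
have bM : b <= M by rewrite lerDr.
have GlipM y y' : enorm (G y - G y') <= M * enorm (y - y').
  rewrite (le_trans (Glip _ _))// ler_wpM2r ?enorm_ge0//.
  by rewrite (le_trans (ler_norm _))// lerDl ltW.
pose tau : R := b / M ^+ 2.
have tau_gt0 : 0 < tau by rewrite divr_gt0// exprn_gt0.
pose T (y : 'rV[R]_n) : 'rV[R]_n := y + tau *: (G y - v).
pose q2 : R := 1 - b ^+ 2 / M ^+ 2.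
have q2_ge0 : 0 <= q2.
  by rewrite subr_ge0 ler_pdivrMr ?exprn_gt0// mul1r ler_pXn2r// nnegrE ltW.
have q2_lt1 : q2 < 1 by rewrite ltrBlDr ltrDl divr_gt0 ?exprn_gt0.
pose q : R := Num.sqrt q2.
have q_ge0 : 0 <= q by exact: sqrtr_ge0.
have q_lt1 : `|q| < 1 by rewrite ger0_norm// -[ltRHS]sqrtr1 ltr_sqrt.
have Tq y y' : enorm (T y - T y') <= q * enorm (y - y').
  rewrite -(@ler_pXn2r _ 2)// ?nnegrE ?mulr_ge0 ?enorm_ge0//.
  rewrite exprMn (sqr_sqrtr q2_ge0).
  have -> : T y - T y' = (y - y') + tau *: (G y - G y').
    by apply/rowP => i; rewrite !mxE; ring.
  rewrite sqr_enormD dotZr dotC enormZ exprMn (real_normK (num_real _)).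
  have h1 := Gmono y y'.
  have h2 : enorm (G y - G y') ^+ 2 <= M ^+ 2 * enorm (y - y') ^+ 2.
    by rewrite -exprMn ler_pXn2r ?nnegrE ?mulr_ge0 ?enorm_ge0// ltW.
  have h3 : tau * M ^+ 2 = b by rewrite divfK// expf_neq0// gt_eqF.
  have h4 : q2 = 1 - tau * b by rewrite /q2 /tau expr2 mulrAC.
  set e := enorm (y - y') ^+ 2 in h1 h2 *.
  have h5 : tau * dot (G y - G y') (y - y') <= tau * (- b * e).
    by rewrite ler_pM2l.
  have h6 : tau ^+ 2 * enorm (G y - G y') ^+ 2 <= tau * b * e.
    have -> : tau * b * e = tau ^+ 2 * (M ^+ 2 * e) by rewrite -h3; ring.
    by rewrite ler_pM2l ?exprn_gt0.
  rewrite h4; lra.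
have TNq N y y' : enorm (iter N T y - iter N T y') <= q ^+ N * enorm (y - y').
  elim: N => [|N IH]; first by rewrite mul1r.
  by rewrite (le_trans (Tq _ _))// exprS -mulrA ler_wpM2l.
(* The factor [n] is the price of returning from the Euclidean norm to the sup norm. *)
have [N Nq] : exists N, q ^+ N * n%:R < 1.
  have : (q ^+ N * n%:R) @[N --> \oo] --> (0 * n%:R : R).
    by apply: cvgMr_tmp; exact: cvg_expr.
  rewrite mul0r => /cvgrPdist_lt /(_ _ ltr01) [N _ /(_ _ (leqnn N))] /=.
  by rewrite sub0r normrN => h; exists N; rewrite (le_lt_trans (ler_norm _)).
pose V : completeNormedModType R :=
  HB.pack 'rV[R]_n (Uniform_isComplete.Build 'rV[R]_n cauchy_cvg).
pose S : {fun [set: V] >-> [set: V]} := totalfun (iter N T).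
have qn_ge0 : 0 <= q ^+ N * n%:R by rewrite mulr_ge0// exprn_ge0.
have Sctr : is_contraction S.
  exists (NngNum qn_ge0); split => //= -[y y'] _ /=.
  rewrite (le_trans (norm_le_enorm _))// (le_trans (TNq _ _ _))//.
  by rewrite -mulrA ler_wpM2l ?exprn_ge0// enorm_le_norm.
have [|y _ yS] := banach_fixed_point Sctr closedT; first by exists 0.
(* [T y] is fixed by the iterate as well, so its distance to [y] is at most [q ^+ N] times itself.
   The bound [q ^+ N * n%:R < 1] gives [q ^+ N < 1] once [n > 0], which a positive distance
   ensures. *)
exists y; have Ty : T y = y.
  apply/subr0_eq/enorm_eq0/eqP; rewrite eq_le enorm_ge0 andbT.
  have := TNq N (T y) y.
  rewrite -iterSr iterS.
  have -> : iter N T y = y by rewrite [RHS]yS.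
  move=> h; apply: contraTT (h); rewrite -!ltNge => d_gt0.
  have n_gt0 : (0 < n)%N.
    have [n0|//] := posnP n; have nR0 : n%:R = 0 :> R by rewrite n0.
    have := enorm_le_norm (T y - y).
    by rewrite nR0 mul0r leNgt d_gt0.
  rewrite -[ltRHS]mul1r ltr_pM2r// (le_lt_trans _ Nq)// ler_peMr ?exprn_ge0//.
  by rewrite ler1n.
move/(congr1 (fun z => tau^-1 *: (z - y))): Ty.
rewrite /T subrr scaler0 addrC addrA addNr add0r scalerA mulVf ?gt_eqF//.
by rewrite scale1r => /subr0_eq.
Qed.

(** * An implicit function theorem for dissipative equations *)

Section Approximation.
Context {R : realType} {V W : normedModType R}.

Lemma diff_approx (h : V -> W) x e : differentiable h x -> 0 < e ->
  \forall u \near 0, `|h (u + x) - h x - 'd h x u| <= e * `|u|.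
Proof.
move=> /diff_locally/eqaddoP hd e_gt0; have := hd _ e_gt0.
by apply: filterS => u; rewrite !fctE/= opprD addrA.
Qed.

Lemma approx_differentiable (h : V -> W) (L : {linear V -> W}) x :
  continuous L ->
  (forall e, 0 < e -> \forall u \near 0, `|h (u + x) - h x - L u| <= e * `|u|) ->
  differentiable h x.
Proof.
move=> Lc hL; have hd : h \o shift x = cst (h x) + L +o_ 0 id.
  apply/eqaddoP => e e_gt0; have := hL _ e_gt0.
  by apply: filterS => u; rewrite !fctE/= opprD addrA.
by apply/diff_locallyP; rewrite (diff_unique Lc hd).
Qed.

Lemma linear_bound_continuous (L : {linear V -> W}) C :
  (forall u, `|L u| <= C * `|u|) -> continuous L.
Proof.
move=> LC; apply/linear_bounded_continuous/bounded_funP => r; exists (`|C| * `|r|).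
move=> u ur; rewrite (le_trans (LC u))// (le_trans (ler_norm _))// normrM normr_id.
by rewrite ler_wpM2l// (le_trans ur)// ler_norm.
Qed.

End Approximation.

(** Cauchy-Schwarz, then division by [enorm d]. This lower bound plays the part of a bounded
    inverse, for [g] and for its linearization alike. *)
Lemma dissipative_enorm {R : realType} {n : nat} (u d : 'rV[R]_n) b :
  0 < b -> dot u d <= - b * enorm d ^+ 2 -> b * enorm d <= enorm u.
Proof.
move=> b_gt0 ud; have [->|d0] := eqVneq (enorm d) 0.
  by rewrite mulr0 enorm_ge0.
have d_gt0 : 0 < enorm d by rewrite lt_neqAle eq_sym d0 enorm_ge0.
rewrite -(ler_pM2r d_gt0) -mulrA -expr2.
have := norm_dot_le u d; rewrite ler_norml => /andP[+ _].
lra.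
Qed.

Section Implicit.
Context {R : realType} {V : normedModType R} {n : nat}.
Variables (g : V * 'rV[R]_n -> 'rV[R]_n) (b : R).
Hypothesis b_gt0 : 0 < b.
Hypothesis g_diss : forall x y y',
  dot (g (x, y) - g (x, y')) (y - y') <= - b * enorm (y - y') ^+ 2.

Lemma dissipative_dist x y y' :
  b * enorm (y - y') <= enorm (g (x, y) - g (x, y')).
Proof. exact/dissipative_enorm/g_diss. Qed.

(** Dissipation between [y] and [y + t u], divided by [t^2], passes to small [t]: the first-order
    remainder is [o(t)] and is paired with [t u]. *)
Lemma diff_dissipative x y u : differentiable g (x, y) ->
  dot ('d g (x, y) (0, u)) u <= - b * enorm u ^+ 2.
Proof.
move=> gd; apply/ler_addgt0Pr => e e_gt0.
(* [C] dominates the factor that Cauchy-Schwarz and the change of norm put on the remainder, so that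
   its pairing with [u] costs at most [t * e]; the 1 keeps it positive. *)
pose C : R := n%:R * `|u| * enorm u + 1.
have C_gt0 : 0 < C by rewrite ltr_wpDl ?mulr_ge0 ?enorm_ge0.
have eC_gt0 : 0 < e / C by rewrite divr_gt0.
have [r /= r_gt0 hr] := (nbhs_ballP _ _).1 (diff_approx gd eC_gt0).
pose t : R := r / 2 / (`|u| + 1).
have u1_gt0 : 0 < `|u| + 1 by rewrite ltr_wpDl.
have t_gt0 : 0 < t by rewrite !divr_gt0.
have : ball 0 r ((0, t *: u) : V * 'rV[R]_n).
  rewrite -ball_normE /= sub0r normrN prod_normE/= normr0.
  rewrite gt_max r_gt0/= normrZ gtr0_norm//.
  have : t * (`|u| + 1) = r / 2 by rewrite divfK// gt_eqF.
  lra.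
move/hr; rewrite /= => {hr}.
have -> : (0, t *: u) = t *: (0, u) :> V * 'rV[R]_n.
  by congr (_, _); rewrite /= scaler0.
rewrite linearZ/= normrZ (gtr0_norm t_gt0).
have -> : `|((0, u) : V * 'rV[R]_n)| = `|u|.
  by rewrite prod_normE/= normr0 (max_idPr _).
have -> : t *: ((0, u) : V * 'rV[R]_n) + (x, y) = (x, t *: u + y).
  by congr (_, _); rewrite /= ?scaler0 ?add0r.
set D := 'd g _ _; set d := _ - _ - _ => hd.
have := g_diss x (t *: u + y) y; rewrite addrK.
have -> : g (x, t *: u + y) - g (x, y) = d + t *: D by rewrite subrK.
rewrite dotDl dotZl !dotZr enormZ (gtr0_norm t_gt0) => h1.
have : `|dot d u| <= t * e.
  rewrite (le_trans (norm_dot_le _ _))//.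
  have := le_trans (enorm_le_norm d) (ler_wpM2l (ler0n _ n) hd).
  move/(ler_wpM2r (enorm_ge0 u))/le_trans; apply.
  have -> : n%:R * (e / C * (t * `|u|)) * enorm u =
    (t * e) * (n%:R * `|u| * enorm u / C) by ring.
  rewrite ler_piMr ?mulr_ge0 ?ltW// ltr_pdivrMr// mul1r; rewrite /C; lra.
rewrite ler_norml => /andP[h2 _].
have h3 : t * (t * dot D u) <= t * (t * (- b * enorm u ^+ 2 + e)) by nra.
by move: h3; rewrite !ler_pM2l.
Qed.

Variable gam : V -> 'rV[R]_n.
Hypothesis g_gam : forall x, g (x, gam x) = 0.

Lemma implicit_continuous x :
  {for x, continuous (fun x' => g (x', gam x))} -> {for x, continuous gam}.
Proof.
move=> gc; apply/cvgrPdist_le => e e_gt0.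
have e'_gt0 : 0 < b * e / n.+1%:R by rewrite divr_gt0 ?mulr_gt0.
move/cvgrPdist_le : gc => /(_ _ e'_gt0); apply: filterS => x' /=.
rewrite g_gam sub0r normrN => h.
rewrite (le_trans (norm_le_enorm _))// -(ler_pM2l b_gt0).
rewrite (le_trans (dissipative_dist x' _ _))// g_gam subr0.
rewrite (le_trans (enorm_le_norm _))// (le_trans (ler_wpM2l _ h))//.
by rewrite mulrCA ger_pMr ?mulr_gt0// ler_pdivrMr// mul1r ler_nat.
Qed.

(** The candidate derivative [L] is the map whose graph is the kernel of the differential [D].
    Coercivity of [D (0, _)] gives its existence, its linearity through uniqueness, and its bound.
    The increment [k] of [gam] then satisfies [D (u, k) = o(max(|u|, |k|))], and coercivity turns
    this into smallness of [k - L u]. *)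
Lemma implicit_differentiable x :
  differentiable g (x, gam x) -> differentiable gam x.
Proof.
move=> gd; pose D : V * 'rV[R]_n -> 'rV[R]_n := 'd g (x, gam x).
have Dlin : linear D by move=> a u v; rewrite /D linearP.
have [C C_gt0 DC] : exists2 C, 0 < C & forall u, `|D u| <= C * `|u|.
  exact/linear_lipschitz/diff_continuous.
have Bdiss u : dot (D (0, u)) u <= - b * enorm u ^+ 2 by exact: diff_dissipative.
have BB u u' : D (0, u) - D (0, u') = D (0, u - u').
  by rewrite /D -linearB; congr ('d g _ _); congr (_, _); rewrite subr0.
have Bsurj w : exists u, D (0, u) = w.
  apply: (@strongly_monotone_surj _ _ (fun u => D (0, u)) b (n%:R * C)) => //.
    by move=> y y'; rewrite BB.
  move=> y y'; rewrite BB (le_trans (enorm_le_norm _))// -mulrA ler_wpM2l//.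
  rewrite (le_trans (DC _))// prod_normE/= normr0 (max_idPr _)//.
  by rewrite ler_pM2l// norm_le_enorm.
have [L DL] : exists L : V -> 'rV[R]_n, forall h, D (h, L h) = 0.
  suff /choice[L DL] : forall h, exists u, D (h, u) = 0 by exists L.
  move=> h; have [u Du] := Bsurj (- D (h, 0)); exists u.
  have -> : (h, u) = 1 *: (h, 0) + (0, u) by congr (_, _); rewrite /= scale1r ?addr0 ?add0r.
  by rewrite Dlin Du scale1r subrr.
(* [(h, k)] differs by [(0, k - L h)] from [(h, L h)], which [D] annihilates. *)
have Linj h k : b * enorm (k - L h) <= enorm (D (h, k)).
  have -> : D (h, k) = D (0, k - L h).
    have -> : (h, k) = 1 *: (h, L h) + (0, k - L h).
      by congr (_, _); rewrite /= scale1r ?addr0// addrC subrK.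
    by rewrite Dlin DL scaler0 add0r.
  exact: dissipative_enorm.
have Llin : linear L.
  move=> a h h'; apply/esym/subr0_eq/enorm_eq0/eqP; rewrite eq_le enorm_ge0 andbT.
  rewrite -(ler_pM2l b_gt0) mulr0 (le_trans (Linj _ _))//.
  have -> : (a *: h + h', a *: L h + L h') = a *: (h, L h) + (h', L h') by [].
  by rewrite Dlin !DL scaler0 addr0 enorm0.
pose Lm := GRing.isLinear.Build _ _ _ _ _ Llin.
pose LL : {linear V -> 'rV[R]_n} := HB.pack L Lm.
have {}DC h k : enorm (D (h, k)) <= n%:R * C * Num.max `|h| `|k|.
  by rewrite (le_trans (enorm_le_norm _))// -mulrA ler_wpM2l// -prod_normE.
have LC u : `|LL u| <= b^-1 * (n%:R * C) * `|u|.
  rewrite (le_trans (norm_le_enorm _))// -mulrA -ler_pdivrMl ?invr_gt0// invrK.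
  have := Linj u 0; rewrite sub0r enormN => /le_trans; apply.
  by rewrite (le_trans (DC _ _))// normr0 (max_idPl _).
have Lc : continuous LL := linear_bound_continuous LC.
apply: (approx_differentiable Lc) => e e_gt0.
have gamc : {for x, continuous gam}.
  apply: implicit_continuous.
  apply: differentiable_continuous.
  apply: (@differentiable_comp _ _ _ _ (fun x' => (x', gam x)) g) => //.
set CL := b^-1 * (n%:R * C) in LC.
have CL_ge0 : 0 <= CL by rewrite !mulr_ge0 ?invr_ge0// ltW.
(* [M] compensates the change of norm and the division by [b], leaving a factor one half. In the
   minimum, 1 lets half of [|k - L u|] be absorbed on the left, and [e / (1 + CL)] leaves at most
   [e * |u|]. *)
pose M : R := 2 * n.+1%:R / b.
have M_gt0 : 0 < M by rewrite divr_gt0// mulr_gt0.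
pose d : R := Num.min 1 (e / (1 + CL)) / M.
have d_gt0 : 0 < d by rewrite divr_gt0// lt_min ltr01 divr_gt0// ltr_wpDr.
have gam0 : (fun u => (u, gam (u + x) - gam x)) @ (0 : V) --> (0 : V * 'rV[R]_n).
  suff h : (fun u => gam (u + x) - gam x) @ (0 : V) --> (0 : 'rV[R]_n).
    have := cvg_pair (@cvg_id _ (nbhs (0 : V))) h.
    by apply; exact: nbhs_filter.
  have xc : u + x @[u --> (0 : V)] --> x.
    have := cvgD (@cvg_id _ (nbhs (0 : V))) (@cvg_cst _ x _ (nbhs (0 : V)) _).
    by rewrite add0r; apply.
  have := cvgB (cvg_comp _ _ xc gamc) (@cvg_cst _ (gam x) _ (nbhs (0 : V)) _).
  by rewrite subrr; apply.
have := gam0 _ (diff_approx gd d_gt0).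
apply: (@filterS _ (nbhs (0 : V))) => u /=.
have -> : (u, gam (u + x) - gam x) + (x, gam x) = (u + x, gam (u + x)).
  by congr (_, _); rewrite /= subrK.
rewrite !g_gam subrr sub0r normrN => h.
set k := gam (u + x) - gam x in h *; rewrite -/(L u).
have h1 : b * `|k - L u| <= n%:R * (d * Num.max `|u| `|k|).
  rewrite (@le_trans _ _ (b * enorm (k - L u)))// ?ler_pM2l ?norm_le_enorm//.
  rewrite (le_trans (Linj _ _))// (le_trans (enorm_le_norm _))// ler_wpM2l//.
have h2 : Num.max `|u| `|k| <= (1 + CL) * `|u| + `|k - L u|.
  rewrite ge_max; apply/andP; split.
    by rewrite mulrDl mul1r -addrA lerDl addr_ge0// mulr_ge0.
  rewrite -[in leLHS](subrK (L u) k) (le_trans (ler_normD _ _))//.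
  rewrite addrC lerD2r (le_trans (LC u))// ler_wpM2r// lerDr//.
have h3 : `|k - L u| <= 2^-1 * Num.min 1 (e / (1 + CL)) * Num.max `|u| `|k|.
  rewrite -(ler_pM2l b_gt0) (le_trans h1)//.
  apply: (@le_trans _ _ (n.+1%:R * (d * Num.max `|u| `|k|))).
    by rewrite ler_wpM2r ?ler_nat// mulr_ge0 ?(ltW d_gt0)// le_max normr_ge0.
  have -> : n.+1%:R * (d * Num.max `|u| `|k|) =
     b * (2^-1 * Num.min 1 (e / (1 + CL)) * Num.max `|u| `|k|) => //.
  by rewrite /d /M; field; rewrite !gt_eqF.
have m1 : Num.min 1 (e / (1 + CL)) <= 1 by rewrite ge_min lexx.
have m2 : Num.min 1 (e / (1 + CL)) * (1 + CL) <= e.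
  by rewrite -ler_pdivlMr ?ltr_wpDr// ge_min lexx orbT.
set m := Num.min 1 _ in h3 m1 m2.
have m_gt0 : 0 < m by rewrite /m lt_min ltr01 divr_gt0// ltr_wpDr.
have h4 : `|k - L u| <= 2^-1 * m * ((1 + CL) * `|u| + `|k - L u|).
  by rewrite (le_trans h3)// ler_pM2l// mulr_gt0.
have h5 : m * ((1 + CL) * `|u|) <= e * `|u| by rewrite mulrA ler_wpM2r.
have h6 : m * `|k - L u| <= `|k - L u| by rewrite ler_piMl.
nra.
Qed.

End Implicit.

(** * Frames and derivatives *)

Section Derivatives.
Context {R : realType} {V W : normedModType R}.

Lemma scaler_is_bilinear :
  bilinear_for
    (GRing.Scale.Law.clone _ _ *:%R _) (GRing.Scale.Law.clone _ _ *:%R _)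
    (@GRing.scale R W).
Proof.
split=> [w|a] c x y /=; first by rewrite scalerDl scalerA.
by rewrite scalerDr !scalerA mulrC.
Qed.
HB.instance Definition _ :=
  bilinear_isBilinear.Build R R W W _ _ (@GRing.scale R W) scaler_is_bilinear.

Lemma differentiable_scale (a : V -> R) (h : V -> W) x :
  differentiable a x -> differentiable h x ->
  differentiable (fun z => a z *: h z) x.
Proof.
move=> da dh.
apply: (@differentiable_comp _ _ _ _ (fun z => (a z, h z)) (fun q => q.1 *: q.2)).
  exact: differentiable_pair.
apply: (@differentiable_bilin _ _ _ _ (@GRing.scale R W : {bilinear R -> W -> W})).
exact: scale_continuous.
Qed.

Lemma derive_scale (a : V -> R) (h : V -> W) x v :
  differentiable a x -> differentiable h x ->
  'D_v (fun z => a z *: h z) x = 'D_v a x *: h x + a x *: 'D_v h x.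
Proof.
move=> da dh; rewrite !deriveE//; last exact: differentiable_scale.
have dp : differentiable (fun z => (a z, h z)) x by exact: differentiable_pair.
have ds : differentiable (fun q : R * W => q.1 *: q.2) (a x, h x).
  apply: (@differentiable_bilin _ _ _ _ (@GRing.scale R W : {bilinear R -> W -> W})).
  exact: scale_continuous.
rewrite (@diff_comp _ _ _ _ (fun z => (a z, h z)) (fun q => q.1 *: q.2))//=.
rewrite (@diff_bilin _ _ _ _ (@GRing.scale R W : {bilinear R -> W -> W}))/=.
  by rewrite diff_pair//= addrC.
exact: scale_continuous.
Qed.

(** The rescaling factor [a] ends on a difference in both terms, so a known rate applies to each of
    them. *)
Lemma scalerB_split (a c1 c2 : R) (u1 u2 : W) :
  a *: (c1 *: u1 - c2 *: u2) =
  c1 *: (a *: (u1 - u2)) + (a * (c1 - c2)) *: u2.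
Proof. by rewrite !scalerBr !scalerA mulrBr scalerBl (mulrC c1) addrA subrK. Qed.

Lemma differentiable_lin (L : {linear V -> W}) (U : normedModType R)
    (h : U -> V) x :
  continuous L -> differentiable h x -> differentiable (fun z => L (h z)) x.
Proof.
move=> Lc dh; apply: (@differentiable_comp _ _ _ _ h L) => //.
exact: linear_differentiable.
Qed.

Lemma derive_lin (L : {linear V -> W}) (U : normedModType R) (h : U -> V) x v :
  continuous L -> differentiable h x ->
  'D_v (fun z => L (h z)) x = L ('D_v h x).
Proof.
move=> Lc dh; rewrite !deriveE//; last exact: differentiable_lin.
rewrite (@diff_comp _ _ _ _ h L)//=; last exact: linear_differentiable.
by rewrite diff_lin.
Qed.

Lemma derive_comp_lin (U : normedModType R) (F : V -> W) (h : U -> V) x v :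
  differentiable h x -> differentiable F (h x) ->
  'D_v (fun z => F (h z)) x = 'D_('D_v h x) F (h x).
Proof.
move=> dh dF; rewrite !deriveE//; last exact: (@differentiable_comp _ _ _ _ h F).
by rewrite (@diff_comp _ _ _ _ h F).
Qed.

Lemma differentiable_fst (q : V * W) : differentiable fst q.
Proof. by apply: linear_differentiable => r; exact: cvg_fst. Qed.

Lemma differentiable_snd (q : V * W) : differentiable snd q.
Proof. by apply: linear_differentiable => r; exact: cvg_snd. Qed.

End Derivatives.

(** A finite spanning family with continuous linear coordinates. [smooth_bounded] bounds derivatives
    in each direction separately; expanding a direction over a frame yields an operator norm bound
    and writes the chain rule as a finite sum of products. *)
Record frame {R : realType} (V : normedModType R) := Frame {
  frame_index : finType;
  frame_vec : frame_index -> V;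
  frame_coord : frame_index -> {linear V -> R};
  frame_coord_continuous : forall i, continuous (frame_coord i);
  frameE : forall v, v = \sum_i frame_coord i v *: frame_vec i }.

Definition rV_coord {R : realType} {n : nat} (i : 'I_n) (u : 'rV[R]_n) : R := u 0 i.

Lemma rV_coord_is_linear {R : realType} {n : nat} (i : 'I_n) :
  linear (@rV_coord R n i).
Proof. by move=> a u v; rewrite /rV_coord !mxE. Qed.

HB.instance Definition _ {R : realType} {n : nat} (i : 'I_n) :=
  GRing.isLinear.Build R 'rV[R]_n R _ (rV_coord i) (rV_coord_is_linear i).

Lemma rV_coord_continuous {R : realType} {n : nat} (i : 'I_n) :
  continuous (@rV_coord R n i).
Proof. exact: coord_continuous. Qed.

Lemma rV_coordZB {R : realType} {n : nat} (i : 'I_n) (c : R) (u v : 'rV[R]_n) :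
  rV_coord i (c *: (u - v)) = c * (rV_coord i u - rV_coord i v).
Proof. by rewrite /rV_coord !mxE. Qed.

Lemma rV_frameE {R : realType} {n : nat} (v : 'rV[R]_n) :
  v = \sum_(i < n) rV_coord i v *: delta_mx 0 i.
Proof. by rewrite [LHS]row_sum_delta. Qed.

Definition rV_frame (R : realType) (n : nat) : frame 'rV[R]_n :=
  Frame (frame_coord := fun i => rV_coord i : {linear 'rV[R]_n -> R})
    rV_coord_continuous rV_frameE.

Section ProductFrame.
Context {R : realType} {V W : normedModType R} (eV : frame V) (eW : frame W).

Definition prod_vec (k : frame_index eV + frame_index eW) : V * W :=
  match k with
  | inl i => (frame_vec i, 0)
  | inr j => (0, frame_vec j)
  end.

Definition prod_coord (k : frame_index eV + frame_index eW) (q : V * W) : R :=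
  match k with
  | inl i => frame_coord i q.1
  | inr j => frame_coord j q.2
  end.

Lemma prod_coord_is_linear k : linear (prod_coord k).
Proof. by case: k => i a u v; rewrite /= linearP. Qed.

HB.instance Definition _ k :=
  GRing.isLinear.Build R (V * W)%type R _ (prod_coord k) (prod_coord_is_linear k).

Lemma prod_coord_continuous k : continuous (prod_coord k).
Proof.
case: k => i q; apply: continuous_comp.
- exact: cvg_fst.
- exact: frame_coord_continuous.
- exact: cvg_snd.
- exact: frame_coord_continuous.
Qed.

Lemma prod_frameE (q : V * W) : q = \sum_k prod_coord k q *: prod_vec k.
Proof.
rewrite big_sumType/=; case: q => v w /=.
rewrite [v in LHS](frameE eV) [w in LHS](frameE eW).
have -> : \sum_(i : frame_index eV) frame_coord i v *: ((frame_vec i, 0) : V * W) =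
    (\sum_(i : frame_index eV) frame_coord i v *: frame_vec i, 0).
  by elim/big_rec2: _ => // i x y _ ->; congr (_, _); rewrite /= scaler0 addr0.
have -> : \sum_(i : frame_index eW) frame_coord i w *: ((0, frame_vec i) : V * W) =
    (0, \sum_(i : frame_index eW) frame_coord i w *: frame_vec i).
  by elim/big_rec2: _ => // i x y _ ->; congr (_, _); rewrite /= scaler0 addr0.
by congr (_, _); rewrite /= ?addr0 ?add0r.
Qed.

Definition prod_frame : frame (V * W)%type :=
  Frame (frame_coord := fun k => prod_coord k : {linear (V * W)%type -> R})
    prod_coord_continuous prod_frameE.

End ProductFrame.

(** * Uniformly bounded families *)

Section MeanValue.
Context {R : realType} {V : normedModType R}.

Lemma derive_frame {W : normedModType R} (e : frame V) (h : V -> W) x v :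
  differentiable h x ->
  'D_v h x = \sum_k frame_coord k v *: 'D_(frame_vec (f := e) k) h x.
Proof.
move=> dh; rewrite deriveE// [in LHS](frameE e v) linear_sum.
by apply: eq_bigr => k _; rewrite linearZ/= deriveE.
Qed.

Lemma ler_derive_frame {W : normedModType R} {I : Type} (e : frame V)
    (h : I -> V -> W) :
  (forall i x, differentiable (h i) x) ->
  (forall v, exists M, forall i x, `|'D_v (h i) x| <= M) ->
  exists2 C, 0 <= C & forall i x v, `|'D_v (h i) x| <= C * `|v|.
Proof.
move=> dh hD; have /choice [M hM] : forall k : frame_index e, exists M,
    forall i x, `|'D_(frame_vec k) (h i) x| <= M by move=> k; exact: hD.
have /choice [c hc] : forall k : frame_index e, exists c : R,
    forall v, `|frame_coord k v| <= c * `|v|.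
  move=> k; have [c _ hc] := linear_lipschitz (@frame_coord_continuous _ _ _ k).
  by exists c.
exists (\sum_k `|c k| * `|M k|); first by apply: sumr_ge0 => k _; rewrite mulr_ge0.
move=> i x v; rewrite (derive_frame e)// (le_trans (ler_norm_sum _ _ _))//.
rewrite mulr_suml; apply: ler_sum => k _; rewrite normrZ mulrAC ler_pM//.
  by rewrite (le_trans (hc k v))// ler_wpM2r// ler_norm.
by rewrite (le_trans (hM k i x))// ler_norm.
Qed.

(** The scalar mean value theorem is applied to each coordinate along the segment; as the sup norm
    is a maximum of coordinates, no dimension factor appears. *)
Lemma mean_value_le {n : nat} (h : V -> 'rV[R]_n) C :
  (forall x, differentiable h x) ->
  (forall x v, `|'D_v h x| <= C * `|v|) ->
  forall x y, `|h x - h y| <= C * `|x - y|.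
Proof.
move=> dh hC x y.
have C0 : 0 <= C * `|x - y| := le_trans (normr_ge0 _) (hC 0 (x - y)).
rewrite [leLHS]mx_normrE; apply: bigmax_le => // -[i j] _; rewrite !ord1 /=.
pose p (t : R) : V := y + t *: (x - y).
have dp t : differentiable p t.
  apply: differentiableD; first exact: differentiable_cst.
  exact: differentiableZl.
have Dp t : 'D_1 p t = x - y.
  rewrite deriveD; first last.
  - by apply/derivable1_diffP/differentiableZl.
  - exact: derivable_cst.
  have did : differentiable (@id R) t by exact: ex_diff.
  rewrite derive_cst add0r (derive_scale _ did (differentiable_cst (x - y) t)).
  by rewrite derive_id derive_cst scaler0 addr0 [LHS]scale1r.
have dhp t : differentiable (h \o p) t by exact: differentiable_comp.
have dphi (t : R) : is_derive t 1 (fun t => rV_coord j (h (p t)))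
    (rV_coord j ('D_(x - y) h (p t))).
  apply: DeriveDef.
    apply/derivable1_diffP.
    exact: (differentiable_lin (@rV_coord_continuous _ _ j) (dhp t)).
  rewrite (derive_lin _ (@rV_coord_continuous _ _ j) (dhp t)).
  by rewrite (derive_comp_lin _ (dp t) (dh (p t))) Dp.
have [|t _] := MVT_segment ler01 (fun t _ => dphi t).
  by apply: derivable_within_continuous => t _; have [] := dphi t.
have -> : p 1 = x by rewrite /p scale1r addrC subrK.
have -> : p 0 = y by rewrite /p scale0r addr0.
rewrite subr0 mulr1 /rV_coord => e.
by rewrite !mxE e (le_trans (coord_le_norm _ _)).
Qed.

End MeanValue.

(* Bounds in [W^{k,oo}] uniform in the index; [unif_smooth] drops the bound on
   the values of the functions themselves, which is needed for [x |-> (x, h x)]. *)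
Fixpoint unif_bounded {R : realType} {I : Type} {V W : normedModType R}
    (k : nat) (h : I -> V -> W) : Prop :=
  (forall i, continuous (h i)) /\ (exists M, forall i x, `|h i x| <= M) /\
  match k with
  | 0%N => True
  | j.+1 => (forall i x, differentiable (h i) x) /\
            (forall v, unif_bounded j (fun i x => 'D_v (h i) x))
  end.

Definition unif_smooth {R : realType} {I : Type} {V W : normedModType R}
    (k : nat) (h : I -> V -> W) : Prop :=
  (forall i, continuous (h i)) /\
  match k with
  | 0%N => True
  | j.+1 => (forall i x, differentiable (h i) x) /\
            (forall v, unif_bounded j (fun i x => 'D_v (h i) x))
  end.

Section UnifBounded.
Context {R : realType} {I : Type}.
Implicit Types (V W : normedModType R) (k : nat).

Lemma unif_boundedW {V W} k (h : I -> V -> W) :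
  unif_bounded k.+1 h -> unif_bounded k h.
Proof.
elim: k V W h => [|k IH] V W h [hc [hM [hd hD]]]; do 2!split => //.
by split => // v; exact: IH.
Qed.

Lemma unif_bounded_le {V W} k l (h : I -> V -> W) :
  (k <= l)%N -> unif_bounded l h -> unif_bounded k h.
Proof.
move=> /subnK <-; elim: (l - k)%N => // m IH; rewrite addSn => /unif_boundedW.
exact: IH.
Qed.

Lemma unif_bounded_smooth {V W} k (h : I -> V -> W) :
  unif_bounded k h -> unif_smooth k h.
Proof. by case: k => [|k] [? [_ ?]]. Qed.

Lemma unif_smoothW {V W} k (h : I -> V -> W) :
  unif_smooth k.+1 h -> unif_smooth k h.
Proof.
move=> [hc hd]; split=> //; case: k hd => // k [d D]; split=> // v.
exact: unif_boundedW.
Qed.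

Lemma unif_boundedP {V W} k (h : I -> V -> W) :
  (exists M, forall i x, `|h i x| <= M) -> unif_smooth k h -> unif_bounded k h.
Proof. by case: k => [|k] hM [hc hd]; split. Qed.

Lemma unif_boundedS {V W} k (h : I -> V -> W) :
  (exists M, forall i x, `|h i x| <= M) -> (forall i x, differentiable (h i) x) ->
  (forall v, unif_bounded k (fun i x => 'D_v (h i) x)) -> unif_bounded k.+1 h.
Proof.
move=> hM hd hD; split; last by [].
by move=> i x; exact: differentiable_continuous.
Qed.

Lemma unif_smoothS {V W} k (h : I -> V -> W) :
  (forall i x, differentiable (h i) x) ->
  (forall v, unif_bounded k (fun i x => 'D_v (h i) x)) -> unif_smooth k.+1 h.
Proof.
by move=> hd hD; split; last by []; move=> i x; exact: differentiable_continuous.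
Qed.

Lemma unif_bounded_cst {V W} k (c : I -> W) :
  (exists M, forall i, `|c i| <= M) -> unif_bounded k (fun i (_ : V) => c i).
Proof.
elim: k c => [|k IH] c [M hM].
  by split; [move=> i; exact: cst_continuous|split=> //; exists M].
apply: unif_boundedS; [by exists M|by move=> i x; exact: differentiable_cst|].
move=> v; under eq_fun do under eq_fun do rewrite derive_cst.
by apply: IH; exists 0 => i; rewrite normr0.
Qed.

Lemma unif_boundedD {V W} k (h1 h2 : I -> V -> W) :
  unif_bounded k h1 -> unif_bounded k h2 ->
  unif_bounded k (fun i x => h1 i x + h2 i x).
Proof.
elim: k h1 h2 => [|k IH] h1 h2.
  move=> [c1 [[M1 hM1] _]] [c2 [[M2 hM2] _]]; split; [|split=> //].
    by move=> i x; apply: cvgD; [exact: c1|exact: c2].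
  by exists (M1 + M2) => i x; rewrite (le_trans (ler_normD _ _))// lerD.
move=> [_ [[M1 hM1] [d1 D1]]] [_ [[M2 hM2] [d2 D2]]]; apply: unif_boundedS.
- by exists (M1 + M2) => i x; rewrite (le_trans (ler_normD _ _))// lerD.
- by move=> i x; exact: differentiableD.
- move=> v; rewrite (_ : (fun _ _ => _) =
      fun i x => 'D_v (h1 i) x + 'D_v (h2 i) x); first exact: IH (D1 v) (D2 v).
  by apply/funext => i; apply/funext => x; rewrite deriveD//; exact: diff_derivable.
Qed.

Lemma unif_bounded_scale {V W} k (a : I -> V -> R) (h : I -> V -> W) :
  unif_bounded k a -> unif_bounded k h ->
  unif_bounded k (fun i x => a i x *: h i x).
Proof.
have bound a' h' : (exists M, forall i x, `|a' i x| <= M) ->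
    (exists M, forall i x, `|h' i x| <= M) ->
    exists M, forall (i : I) (x : V), `|a' i x *: h' i x : W| <= M.
  move=> [M1 hM1] [M2 hM2]; exists (M1 * M2) => i x.
  by rewrite normrZ ler_pM.
elim: k a h => [|k IH] a h.
  move=> [c1 [M1 _]] [c2 [M2 _]]; split; [|split=> //; exact: bound].
  by move=> i x; apply: cvgZ; [exact: c1|exact: c2].
move=> A H; have := A; have := H.
move=> [_ [M1 [d1 D1]]] [_ [M2 [d2 D2]]]; apply: unif_boundedS.
- exact: bound.
- by move=> i x; exact: differentiable_scale.
- move=> v; rewrite (_ : (fun _ _ => _) =
      fun i x => 'D_v (a i) x *: h i x + a i x *: 'D_v (h i) x).
    apply: unif_boundedD.
      exact: IH (D2 v) (unif_boundedW H).
    exact: IH (unif_boundedW A) (D1 v).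
  by apply/funext => i; apply/funext => x; rewrite derive_scale.
Qed.

Lemma unif_bounded_lin {V W U : normedModType R} k (L : {linear W -> U})
    (h : I -> V -> W) :
  continuous L -> unif_bounded k h -> unif_bounded k (fun i x => L (h i x)).
Proof.
move=> Lc; have [c c_gt0 hc] := linear_lipschitz Lc.
have bound h' : (exists M, forall i x, `|h' i x| <= M) ->
    exists M, forall (i : I) (x : V), `|L (h' i x)| <= M.
  by move=> [M hM]; exists (c * M) => i x; rewrite (le_trans (hc _))// ler_pM2l.
elim: k h => [|k IH] h.
  move=> [hcont [M1 _]]; split; [|split=> //; exact: bound].
  by move=> i x; apply: continuous_comp; [exact: hcont|exact: Lc].
move=> [_ [M1 [d1 D1]]]; apply: unif_boundedS.
- exact: bound.
- by move=> i x; exact: differentiable_lin.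
- move=> v; rewrite (_ : (fun _ _ => _) = fun i x => L ('D_v (h i) x)).
    exact: IH (D1 v).
  by apply/funext => i; apply/funext => x; rewrite derive_lin.
Qed.

Lemma unif_boundedZ {V W} k (c : R) (h : I -> V -> W) :
  unif_bounded k h -> unif_bounded k (fun i x => c *: h i x).
Proof.
move=> hk; apply: (@unif_bounded_scale _ _ _ (fun _ _ => c)) => //.
by apply: unif_bounded_cst; exists `|c|.
Qed.

Lemma unif_boundedB {V W} k (h1 h2 : I -> V -> W) :
  unif_bounded k h1 -> unif_bounded k h2 ->
  unif_bounded k (fun i x => h1 i x - h2 i x).
Proof.
move=> k1 k2; rewrite (_ : (fun _ _ => _) = fun i x => h1 i x + -1 *: h2 i x).
  by apply: unif_boundedD => //; exact: unif_boundedZ.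
by apply/funext => i; apply/funext => x; rewrite scaleN1r.
Qed.

Lemma unif_bounded_sum {V W} {J : Type} k (s : seq J) (h : J -> I -> V -> W) :
  (forall j, unif_bounded k (h j)) ->
  unif_bounded k (fun i x => \sum_(j <- s) h j i x).
Proof.
move=> hk; elim: s => [|j s IH].
  under eq_fun do under eq_fun do rewrite big_nil.
  by apply: unif_bounded_cst; exists 0 => i; rewrite normr0.
under eq_fun do under eq_fun do rewrite big_cons.
exact: unif_boundedD.
Qed.

End UnifBounded.

Lemma smooth_bounded_unif {R : realType} {I : Type} {V W : normedModType R} k
    (h : V -> W) :
  smooth_bounded k h -> unif_bounded k (fun _ : I => h).
Proof.
elim: k h => [|k IH] h [hc [[M hM] hd]]; split=> //; split=> //; try by exists M.
by case: hd => d D; split => // v; exact: IH (D v).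
Qed.

Section BigSum.
Context {R : realType} {V W : normedModType R} {J : Type}.
Variables (h : J -> V -> W) (x : V).
Hypothesis dh : forall j, differentiable (h j) x.

Lemma differentiable_bigsum (s : seq J) :
  differentiable (fun z => \sum_(j <- s) h j z) x.
Proof.
elim: s => [|j s IH].
  by under eq_fun do rewrite big_nil; exact: differentiable_cst.
by under eq_fun do rewrite big_cons; exact: differentiableD.
Qed.

Lemma derive_bigsum (s : seq J) v :
  'D_v (fun z => \sum_(j <- s) h j z) x = \sum_(j <- s) 'D_v (h j) x.
Proof.
elim: s => [|j s IH].
  by under eq_fun do rewrite big_nil; rewrite big_nil derive_cst.
under eq_fun do rewrite big_cons.
rewrite big_cons -IH deriveD//; apply: diff_derivable => //.
exact: differentiable_bigsum.
Qed.

End BigSum.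

(** * Composition, and rates of convergence under composition *)

Section Composition.
Context {R : realType} {I : Type} {V U : normedModType R} (e : frame U).

Lemma derive_comp_frame {W : normedModType R} (F : U -> W) (h : V -> U) x v :
  differentiable h x -> differentiable F (h x) ->
  'D_v (fun z => F (h z)) x =
  \sum_k frame_coord k ('D_v h x) *: 'D_(frame_vec (f := e) k) F (h x).
Proof. by move=> dh dF; rewrite derive_comp_lin// (derive_frame e). Qed.

(** The inner family may take unbounded values: it only serves as the point where [F] and its
    derivatives are evaluated, while its derivatives enter as bounded factors. This admits the
    graphs [x |-> (x, Gamma x)]. *)
Lemma unif_bounded_comp {W : normedModType R} k (F : U -> W) (h : I -> V -> U) :
  unif_bounded k (fun _ : I => F) -> unif_smooth k h ->
  unif_bounded k (fun i x => F (h i x)).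
Proof.
elim: k F => [|k IH] F Fk hk.
  have [Fc [[M hM] _]] := Fk; have [hc _] := hk.
  split; [|split=> //; by exists M => i x; exact: hM].
  by move=> i x; apply: continuous_comp; [exact: hc|exact: Fc].
have hk' := unif_smoothW hk.
have [_ [[M hM] [dF DF]]] := Fk; have [_ [dh Dh]] := hk.
apply: unif_boundedS.
- by exists M => i x; exact: hM.
- by move=> i x; apply: (@differentiable_comp _ _ _ _ (h i) F) => //; exact: dF.
- move=> v; rewrite (_ : (fun _ _ => _) = fun i x => \sum_(l : frame_index e)
      frame_coord l ('D_v (h i) x) *: 'D_(frame_vec l) F (h i x)).
    apply: unif_bounded_sum => l; apply: unif_bounded_scale.
      by apply: unif_bounded_lin; [exact: frame_coord_continuous|exact: Dh].
    exact: IH (DF _) hk'.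
  apply/funext => i; apply/funext => x; rewrite derive_comp_frame//; exact: dF.
Qed.

Lemma comp_diff_le {n : nat} (F : U -> 'rV[R]_n) (h1 h2 : I -> V -> U)
    (a : I -> R) :
  unif_bounded 1 (fun _ : I => F) ->
  (exists M, forall i x, `|a i *: (h1 i x - h2 i x)| <= M) ->
  exists M, forall i x, `|a i *: (F (h1 i x) - F (h2 i x))| <= M.
Proof.
move=> [_ [_ [dF DF]]] [M hM].
have [C C_ge0 hC] := ler_derive_frame e dF (fun v => proj1 (proj2 (DF v))).
exists (C * M) => i x; rewrite normrZ.
rewrite (@le_trans _ _ (C * (`|a i| * `|h1 i x - h2 i x|)))//.
  by rewrite mulrCA ler_wpM2l//; exact: (mean_value_le (dF i) (hC i)).
by rewrite -normrZ ler_wpM2l.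
Qed.

(** The derivative of the difference splits into a difference of derivatives of [F] at two points,
    handled by induction, and a difference of inner derivatives, which is the given rate. [F] needs
    one order more because its values are compared by the mean value bound. *)
Lemma unif_bounded_comp_diff {n : nat} k (F : U -> 'rV[R]_n)
    (h1 h2 : I -> V -> U) (a : I -> R) :
  unif_bounded k.+1 (fun _ : I => F) -> unif_smooth k h1 -> unif_smooth k h2 ->
  unif_bounded k (fun i x => a i *: (h1 i x - h2 i x)) ->
  unif_bounded k (fun i x => a i *: (F (h1 i x) - F (h2 i x))).
Proof.
elim: k F => [|k IH] F Fk h1k h2k hk; have [_ [_ [dF DF]]] := Fk;
    have hM := comp_diff_le (unif_bounded_le (ltn0Sn _) Fk) (proj1 (proj2 hk)).
  split=> // i x; have [Fc _] := Fk; have [c1 _] := h1k; have [c2 _] := h2k.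
  apply: cvgZ; [exact: cvg_cst|apply: cvgB].
    by apply: continuous_comp; [exact: c1|exact: Fc].
  by apply: continuous_comp; [exact: c2|exact: Fc].
have [_ [d1 D1]] := h1k; have [_ [d2 D2]] := h2k; have [_ [_ [dh Dh]]] := hk.
have dF1 i x : differentiable (fun z => F (h1 i z)) x.
  by apply: (@differentiable_comp _ _ _ _ (h1 i) F) => //; exact: dF.
have dF2 i x : differentiable (fun z => F (h2 i z)) x.
  by apply: (@differentiable_comp _ _ _ _ (h2 i) F) => //; exact: dF.
apply: unif_boundedS => // [i x|v].
  exact/differentiableZ/differentiableB.
rewrite (_ : (fun _ _ => _) = fun i x => \sum_(l : frame_index e)
   (frame_coord l ('D_v (h1 i) x) *:
      (a i *: ('D_(frame_vec l) F (h1 i x) - 'D_(frame_vec l) F (h2 i x))) +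
    frame_coord l (a i *: ('D_v (h1 i) x - 'D_v (h2 i) x)) *:
      'D_(frame_vec l) F (h2 i x))).
  apply: unif_bounded_sum => l; apply: unif_boundedD; apply: unif_bounded_scale.
  - by apply: unif_bounded_lin; [exact: frame_coord_continuous|exact: D1].
  - apply: (IH _ (DF (frame_vec l))); [exact: unif_smoothW|exact: unif_smoothW|].
    exact: unif_boundedW.
  - apply: unif_bounded_lin; first exact: frame_coord_continuous.
    have := Dh v; congr unif_bounded; apply/funext => i; apply/funext => x.
    rewrite deriveZ; last by apply: derivableB; exact: diff_derivable.
    by rewrite deriveB//; exact: diff_derivable.
  - exact: unif_bounded_comp (unif_boundedW (DF _)) (unif_smoothW h2k).
apply/funext => i; apply/funext => x.
rewrite deriveZ; last by apply: derivableB; exact: diff_derivable.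
rewrite deriveB; [|exact: diff_derivable|exact: diff_derivable].
rewrite !derive_comp_frame//; [|exact: dF|exact: dF].
rewrite -sumrB scaler_sumr; apply: eq_bigr => l _.
have -> : frame_coord l (a i *: ('D_v (h1 i) x - 'D_v (h2 i) x)) =
    a i * (frame_coord l ('D_v (h1 i) x) - frame_coord l ('D_v (h2 i) x)).
  by rewrite linearZ/= linearB.
exact: scalerB_split.
Qed.

End Composition.

(** * Linear systems with a uniformly coercive matrix, [G l] being its [l]-th column *)

Section LinearSolve.
Context {R : realType} {I : Type} {V : normedModType R} {n : nat}.
Variables (b : R) (G : 'I_n -> I -> V -> 'rV[R]_n).
Hypothesis b_gt0 : 0 < b.
Hypothesis G_diss : forall i x u,
  dot (\sum_l rV_coord l u *: G l i x) u <= - b * enorm u ^+ 2.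

Lemma unif_bounded_linear_solve k (s w : I -> V -> 'rV[R]_n) :
  (forall l, unif_bounded k (G l)) -> unif_bounded k s ->
  (forall i x, \sum_l rV_coord l (w i x) *: G l i x = s i x) ->
  unif_bounded k w.
Proof.
pose g i (q : V * 'rV[R]_n) := \sum_l rV_coord l q.2 *: G l i q.1 - s i q.1.
have g_diss s' i x y y' :
    dot ((\sum_l rV_coord l y *: G l i x - s') -
         (\sum_l rV_coord l y' *: G l i x - s')) (y - y') <=
    - b * enorm (y - y') ^+ 2.
  rewrite opprB addrA subrK -sumrB (le_trans _ (G_diss i x (y - y')))//.
  by under eq_bigr do rewrite -scalerBl -linearB.
have bound s' w' : (exists M, forall i x, `|s' i x| <= M) ->
   (forall i x, \sum_l rV_coord l (w' i x) *: G l i x = s' i x) ->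
   exists M, forall i x, `|w' i x| <= M.
  move=> [M hM] sw; exists (b^-1 * (n%:R * M)) => i x.
  rewrite (le_trans (norm_le_enorm _))// -ler_pdivrMl ?invr_gt0// invrK.
  have := dissipative_enorm b_gt0 (G_diss i x (w' i x)).
  rewrite sw => /le_trans; apply.
  by rewrite (le_trans (enorm_le_norm _))// ler_wpM2l.
elim: k s w {g} => [|k IH] s w Gk sk sw; have [sc [sM sd]] := sk.
all: have wM := bound _ _ sM sw.
all: pose g i (q : V * 'rV[R]_n) := \sum_l rV_coord l q.2 *: G l i q.1 - s i q.1.
all: have gw i x : g i (x, w i x) = 0 by rewrite /g sw subrr.
  split=> // i x; have gi_diss z y y' := g_diss (s i z) i z y y'.
  apply: (@implicit_continuous _ _ _ (g i) b b_gt0 gi_diss (w i) (gw i)).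
  suff [gc _] : unif_bounded 0 (fun i z => g i (z, w i x)) by exact: gc.
  apply: unif_boundedB sk; apply: unif_bounded_sum => l.
  apply: unif_bounded_scale => //; apply: (@unif_bounded_lin _ _ V) => //.
    exact: rV_coord_continuous.
  by apply: unif_bounded_cst; case: wM => M hM; exists M => j.
have dw i x : differentiable (w i) x.
  have gi_diss z y y' := g_diss (s i z) i z y y'.
  apply: (@implicit_differentiable _ _ _ (g i) b b_gt0 gi_diss (w i) (gw i)).
  apply: differentiableB; last first.
    apply: (@differentiable_comp _ _ _ _ fst (s i)); last exact: sd.1.
    exact: differentiable_fst.
  apply: differentiable_bigsum => l; apply: differentiable_scale.
    apply: differentiable_lin; first exact: rV_coord_continuous.
    exact: differentiable_snd.
  apply: (@differentiable_comp _ _ _ _ fst (G l i)).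
    exact: differentiable_fst.
  by have [_ [_ [dG _]]] := Gk l; exact: dG.
(* The differentiated right-hand side contains [w] itself, so its order [k] must be known first. *)
have wk : unif_bounded k w.
  by apply: (IH s) => //; [move=> l|]; exact: unif_boundedW.
apply: unif_boundedS => // v.
apply: (IH (fun i x => 'D_v (s i) x - \sum_l rV_coord l (w i x) *: 'D_v (G l i) x)).
- by move=> l; exact: unif_boundedW.
- apply: unif_boundedB; first exact: sd.2.
  apply: unif_bounded_sum => l; apply: unif_bounded_scale.
    by apply: unif_bounded_lin => //; exact: rV_coord_continuous.
  by have [_ [_ [_ DG]]] := Gk l; exact: DG.
move=> i x.
have dG l : differentiable (G l i) x by have [_ [_ [dG _]]] := Gk l.
have dwl (l : 'I_n) : differentiable (fun z => rV_coord l (w i z)) x.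
  by apply: differentiable_lin => //; exact: rV_coord_continuous.
have <- : (fun z => \sum_l rV_coord l (w i z) *: G l i z) = s i by exact/funext.
rewrite derive_bigsum => [|l]; last exact: differentiable_scale.
rewrite -sumrB; apply: eq_bigr => l _.
rewrite derive_scale// derive_lin ?addrK//; exact: rV_coord_continuous.
Qed.

End LinearSolve.

(** * Slow manifolds *)

(** Two systems [w + \sum_l c l *: u l] are subtracted so that the rescaled difference of the
    unknowns [c] solves a system with the single matrix [u1]; every source term is a rescaled
    difference of data. *)
Lemma linear_residual_split {R : realType} {W : normedModType R} {n : nat} (a : R)
    (c1 c2 : 'I_n -> R) (u1 u2 : 'I_n -> W) (w1 w2 : W) :
  \sum_l (a * (c1 l - c2 l)) *: u1 l =
  a *: ((w1 + \sum_l c1 l *: u1 l) - (w2 + \sum_l c2 l *: u2 l)) -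
  a *: (w1 - w2) - \sum_l c2 l *: (a *: (u1 l - u2 l)).
Proof.
have -> : \sum_l (a * (c1 l - c2 l)) *: u1 l =
    a *: (\sum_l c1 l *: u1 l - \sum_l c2 l *: u1 l).
  rewrite -sumrB scaler_sumr; apply: eq_bigr => l _.
  by rewrite -scalerA scalerBl.
have -> : \sum_l c2 l *: (a *: (u1 l - u2 l)) =
    a *: (\sum_l c2 l *: u1 l - \sum_l c2 l *: u2 l).
  rewrite -sumrB scaler_sumr; apply: eq_bigr => l _.
  by rewrite -scalerBr !scalerA mulrC.
rewrite -!scalerBr; congr (_ *: _).
rewrite [w1 + _ - _](_ : _ = (w1 - w2) + (\sum_l c1 l *: u1 l - \sum_l c2 l *: u2 l)).
  by rewrite [X in _ = X - _]addrAC subrr add0r opprB subrKA.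
by rewrite opprD addrACA.
Qed.

Section Pair.
Context {R : realType} {I : Type} {V W U : normedModType R}.

Lemma derive_pair (h1 : V -> W) (h2 : V -> U) x v :
  differentiable h1 x -> differentiable h2 x ->
  'D_v (fun z => (h1 z, h2 z)) x = ('D_v h1 x, 'D_v h2 x).
Proof.
move=> d1 d2; rewrite !deriveE//; last exact: differentiable_pair.
by rewrite diff_pair.
Qed.

Lemma continuous_pair (h1 : V -> W) (h2 : V -> U) x :
  {for x, continuous h1} -> {for x, continuous h2} ->
  {for x, continuous (fun z => (h1 z, h2 z))}.
Proof.
move=> c1 c2; have := cvg_pair c1 c2; apply; exact: nbhs_filter.
Qed.

End Pair.

Lemma unif_bounded_pair {R : realType} {I : Type} {V W U : normedModType R} k
    (h1 : I -> V -> W) (h2 : I -> V -> U) :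
  unif_bounded k h1 -> unif_bounded k h2 ->
  unif_bounded k (fun i x => (h1 i x, h2 i x)).
Proof.
have bound h1' h2' : (exists M, forall i x, `|h1' i x| <= M) ->
    (exists M, forall i x, `|h2' i x| <= M) ->
    exists M, forall (i : I) (x : V), `|(h1' i x : W, h2' i x : U)| <= M.
  move=> [M1 hM1] [M2 hM2]; exists (Num.max M1 M2) => i x.
  by rewrite prod_normE/= ge_max !le_max hM1 hM2 orbT.
elim: k h1 h2 => [|k IH] h1 h2.
  move=> [c1 [M1 _]] [c2 [M2 _]]; split; [|split=> //; exact: bound].
  by move=> i x; apply: continuous_pair; [exact: c1|exact: c2].
move=> [_ [M1 [d1 D1]]] [_ [M2 [d2 D2]]]; apply: unif_boundedS.
- exact: bound.
- by move=> i x; exact: differentiable_pair.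
- move=> v; rewrite (_ : (fun _ _ => _) =
      fun i x => ('D_v (h1 i) x, 'D_v (h2 i) x)); first exact: IH (D1 v) (D2 v).
  by apply/funext => i; apply/funext => x; rewrite derive_pair.
Qed.

Lemma unif_smooth_graph {R : realType} {I : Type} {V W : normedModType R} k
    (h : I -> V -> W) :
  unif_smooth k h -> unif_smooth k (fun i x => (x, h i x)).
Proof.
case: k => [|k] [hc hd].
  by split=> // i x; apply: continuous_pair; [exact: cvg_id|exact: hc].
case: hd => hd hD; apply: unif_smoothS => [i x|v].
  by apply: differentiable_pair => //; exact: ex_diff.
rewrite (_ : (fun _ _ => _) = fun i x => (v, 'D_v (h i) x)).
  by apply: unif_bounded_pair => //; apply: unif_bounded_cst; exists `|v|.
apply/funext => i; apply/funext => x; by rewrite derive_pair// derive_id.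
Qed.

Section SlowManifold.
Context {R : realType} {nx ny : nat}.
Local Notation vx := 'rV[R]_nx.
Local Notation vy := 'rV[R]_ny.
Variables (f : vx * vy -> vx) (g : vx * vy -> vy) (K : nat) (b : R).
Hypothesis f_smooth : smooth_bounded K f.
Hypothesis g_diff : forall z, differentiable g z.
Hypothesis g_smooth : forall v, smooth_bounded K (fun z => 'D_v g z).
Hypothesis b_gt0 : 0 < b.
Hypothesis g_diss : forall x y y',
  dot (g (x, y) - g (x, y')) (y - y') <= - b * enorm (y - y') ^+ 2.

Let e := prod_frame (rV_frame R nx) (rV_frame R ny).

(** The bounded gradient makes [g (x, _)] Lipschitz and dissipation makes it strongly monotone,
    hence surjective; the choice made in [solve_fast] is therefore a genuine solution. *)
Lemma solve_fastP x v : g (x, solve_fast g x v) = v.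
Proof.
apply: (@getPex _ [set y | g (x, y) = v]).
have [|C C_ge0 hC] := ler_derive_frame e (h := fun _ : unit => g) (fun _ => g_diff).
  move=> w; have := unif_bounded_le (leq0n K) (smooth_bounded_unif (I := unit) (g_smooth w)).
  by move=> [_ [+ _]].
apply: (@strongly_monotone_surj _ _ (fun y => g (x, y)) b (ny%:R * C)) => //.
move=> y y'; rewrite (le_trans (enorm_le_norm _))// -mulrA ler_wpM2l//.
rewrite (le_trans (mean_value_le g_diff (hC tt) _ _))// ler_wpM2l//.
by rewrite prod_normE/= subrr normr0 (max_idPr _)// norm_le_enorm.
Qed.

(** The [l]-th column of the Jacobian of [g] in the fast variable. *)
Definition fast_partial (l : 'I_ny) (z : vx * vy) : vy := 'D_(0, delta_mx 0 l) g z.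

Lemma derive_fast z v (w : vy) :
  'D_(v, w) g z = 'D_(v, 0) g z + \sum_l rV_coord l w *: fast_partial l z.
Proof.
have -> : (v, w) = (v, 0) + (0, w) :> vx * vy by congr (_, _); rewrite /= ?addr0 ?add0r.
rewrite deriveE// linearD/= -!deriveE//; congr (_ + _).
rewrite deriveE// [in LHS](rV_frameE w).
have -> : ((0, \sum_l rV_coord l w *: delta_mx 0 l) : vx * vy) =
    \sum_(l < ny) rV_coord l w *: ((0, delta_mx 0 l) : vx * vy).
  by elim/big_rec2: _ => // i p q _ <-; congr (_, _); rewrite /= scaler0 addr0.
by rewrite linear_sum; apply: eq_bigr => l _; rewrite linearZ/= -deriveE.
Qed.

Lemma fast_partial_diss z u :
  dot (\sum_l rV_coord l u *: fast_partial l z) u <= - b * enorm u ^+ 2.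
Proof.
have -> : \sum_l rV_coord l u *: fast_partial l z = 'D_(0, u) g z.
  by rewrite derive_fast derive0 add0r.
by case: z => x y; rewrite deriveE//; exact: diff_dissipative.
Qed.

Section Families.
Context {I : Type}.

Lemma fast_partial_comp k (G : I -> vx -> vy) l :
  (k <= K)%N -> unif_smooth k G ->
  unif_bounded k (fun i x => fast_partial l (x, G i x)).
Proof.
move=> kK /unif_smooth_graph; apply: (unif_bounded_comp e).
exact/(unif_bounded_le kK)/smooth_bounded_unif/g_smooth.
Qed.

Section Equation.
Variables (G r : I -> vx -> vy).
Hypothesis Gr : forall i x, g (x, G i x) = r i x.

Let res_diss i x y y' :
  dot ((g (x, y) - r i x) - (g (x, y') - r i x)) (y - y') <=
  - b * enorm (y - y') ^+ 2.
Proof. by rewrite opprB addrA subrK. Qed.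

Let res_G i x : g (x, G i x) - r i x = 0.
Proof. by rewrite Gr subrr. Qed.

Lemma solution_differentiable i x : differentiable (r i) x -> differentiable (G i) x.
Proof.
move=> dr.
apply: (@implicit_differentiable _ _ _ (fun q => g q - r i q.1) b b_gt0 (res_diss i)
  (G i) (res_G i)).
apply: differentiableB => //.
apply: (@differentiable_comp _ _ _ _ fst (r i)) => //.
exact: differentiable_fst.
Qed.

Lemma solution_continuous i : continuous (r i) -> continuous (G i).
Proof.
move=> rc x; apply: (@implicit_continuous _ _ _ (fun q => g q - r i q.1) b b_gt0 (res_diss i)
  (G i) (res_G i)).
suff gc : {for x, continuous (fun z => g (z, G i x))} 
  by have := cvgB gc (rc x); apply; exact: nbhs_filter.
apply: (@continuous_comp _ _ _ (fun z => (z, G i x)) g).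
  by apply: continuous_pair; [move=> ?; exact: cvg_id|exact: cst_continuous].
exact: differentiable_continuous.
Qed.

Lemma derive_equation i x v : differentiable (G i) x ->
  'D_v (r i) x = 'D_(v, 0) g (x, G i x) +
    \sum_l rV_coord l ('D_v (G i) x) *: fast_partial l (x, G i x).
Proof.
move=> dG; have <- : (fun z => g (z, G i z)) = r i by apply/funext => z.
have did : differentiable (@id vx) x by exact: ex_diff.
rewrite (@derive_comp_lin _ _ _ _ _ (fun z => (z, G i z)))//; last first.
  exact: differentiable_pair.
by rewrite derive_pair// derive_id derive_fast.
Qed.

(** Bootstrap: at order [j] of [G] the coefficients of the linear system for ['D_v G] have order
    [j], so the derivative has order [j] and [G] gains one order, until the regularity of [r] is
    reached. *)
Lemma solution_smooth k : (k <= K)%N -> unif_smooth k.+1 r -> unif_smooth k.+1 G.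
Proof.
move=> kK [rc [rd rD]].
have Gd i x : differentiable (G i) x by exact: solution_differentiable.
have Gc i : continuous (G i) by exact: solution_continuous.
suff : forall j, (j <= k.+1)%N -> unif_smooth j G by apply.
elim=> [|j IH] jk; first by split.
have jK : (j <= K)%N by rewrite (leq_trans _ kK).
have Gj := IH (ltnW jk).
apply: unif_smoothS => // v.
apply: (@unif_bounded_linear_solve _ _ _ _ b
  (fun l i x => fast_partial l (x, G i x)) b_gt0 _ _
  (fun i x => 'D_v (r i) x - 'D_(v, 0) g (x, G i x))).
- by move=> i x u; exact: fast_partial_diss.
- by move=> l; exact: fast_partial_comp.
- apply: unif_boundedB; first exact: unif_bounded_le (rD v).
  apply: (@unif_bounded_comp _ _ _ _ e _ _ (fun z => 'D_(v, 0) g z)); last first.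
    exact: unif_smooth_graph.
  exact/(unif_bounded_le jK)/smooth_bounded_unif/g_smooth.
- by move=> i x; rewrite derive_equation// addrAC subrr add0r.
Qed.

End Equation.

(** Dissipation transfers the rate of the right-hand sides to the values. For derivatives the two
    differentiated equations are subtracted: the unknown solves a coercive system along [G1], and
    the sources also contain differences of derivatives of [g] along the two graphs, controlled by
    the rate one order lower. *)
Lemma solution_diff_bounded k (a : I -> R) (G1 G2 r1 r2 : I -> vx -> vy) :
  (forall i x, g (x, G1 i x) = r1 i x) -> (forall i x, g (x, G2 i x) = r2 i x) ->
  (k <= K)%N -> unif_smooth k G1 -> unif_smooth k G2 ->
  unif_bounded k (fun i x => a i *: (r1 i x - r2 i x)) ->
  unif_bounded k (fun i x => a i *: (G1 i x - G2 i x)).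
Proof.
move=> Gr1 Gr2.
have bound : (exists M, forall i x, `|a i *: (r1 i x - r2 i x)| <= M) ->
    exists M, forall i x, `|a i *: (G1 i x - G2 i x)| <= M.
  move=> [M hM]; exists (b^-1 * (ny%:R * M)) => i x.
  rewrite normrZ (le_trans (ler_wpM2l _ (norm_le_enorm _)))//.
  rewrite -ler_pdivrMl ?invr_gt0// invrK mulrCA.
  have := dissipative_dist b_gt0 g_diss x (G1 i x) (G2 i x).
  move/(ler_wpM2l (normr_ge0 (a i)))/le_trans; apply.
  by rewrite Gr1 Gr2 -enormZ (le_trans (enorm_le_norm _))// ler_wpM2l.
elim: k => [|k IH] kK G1k G2k rk.
  have [_ [rM _]] := rk; apply: unif_boundedP; first exact: bound.
  split=> // i x; have [c1 _] := G1k; have [c2 _] := G2k.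
  have := cvgZ (@cvg_cst _ (a i) _ (nbhs x) _) (cvgB (c1 i x) (c2 i x)); apply; exact: nbhs_filter.
have [_ [rM [rd rD]]] := rk.
have [_ [d1 D1]] := G1k; have [_ [d2 D2]] := G2k.
(* [rd] concerns only the rescaled difference; differentiability of [r1] and [r2] separately is read
   off from the equations. *)
have dr (G r : I -> vx -> vy) i x : (forall i x, g (x, G i x) = r i x) ->
    differentiable (G i) x -> differentiable (r i) x.
  move=> Gr dG; have <- : (fun z => g (z, G i z)) = r i by apply/funext => z.
  apply: (@differentiable_comp _ _ _ _ (fun z => (z, G i z)) g) => //.
  by apply: differentiable_pair => //; exact: ex_diff.
have dr1 i x := dr _ _ i x Gr1 (d1 i x); have dr2 i x := dr _ _ i x Gr2 (d2 i x).
have deriveZB (h1 h2 : I -> vx -> vy) i x v : differentiable (h1 i) x ->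
    differentiable (h2 i) x ->
    'D_v (fun z => a i *: (h1 i z - h2 i z)) x =
    a i *: ('D_v (h1 i) x - 'D_v (h2 i) x).
  move=> dh1 dh2; rewrite deriveZ; last by apply: derivableB; exact: diff_derivable.
  by rewrite deriveB//; exact: diff_derivable.
have {}IH := IH (ltnW kK) (unif_smoothW G1k) (unif_smoothW G2k) (unif_boundedW rk).
have graphk : unif_bounded k (fun i x => a i *: ((x, G1 i x) - (x, G2 i x))).
  rewrite (_ : (fun _ _ => _) =
      fun i (x : vx) => ((0 : vx), a i *: (G1 i x - G2 i x))).
    by apply: unif_bounded_pair => //; apply: unif_bounded_cst; exists 0 => i; rewrite normr0.
  by apply/funext => i; apply/funext => x; congr (_, _); rewrite /= subrr scaler0.
have partial_diff v :
    unif_bounded k (fun i x => a i *: ('D_v g (x, G1 i x) - 'D_v g (x, G2 i x))).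
  apply: (@unif_bounded_comp_diff _ _ _ _ e _ _ (fun z => 'D_v g z) _ _ _ _ _ _ graphk).
  - exact/(unif_bounded_le kK)/smooth_bounded_unif/g_smooth.
  - exact/unif_smooth_graph/unif_smoothW.
  - exact/unif_smooth_graph/unif_smoothW.
apply: unif_boundedS; first exact: bound.
  by move=> i x; exact/differentiableZ/differentiableB.
move=> v.
apply: (@unif_bounded_linear_solve _ _ _ _ b
  (fun l i x => fast_partial l (x, G1 i x)) b_gt0 _ _
  (fun i x => 'D_v (fun z => a i *: (r1 i z - r2 i z)) x
     - a i *: ('D_(v, 0) g (x, G1 i x) - 'D_(v, 0) g (x, G2 i x))
     - \sum_l rV_coord l ('D_v (G2 i) x) *:
          (a i *: (fast_partial l (x, G1 i x) - fast_partial l (x, G2 i x))))).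
- by move=> i x u; exact: fast_partial_diss.
- by move=> l; apply: fast_partial_comp; [exact: ltnW|exact: unif_smoothW].
- apply: unif_boundedB; first exact: unif_boundedB (rD v) (partial_diff _).
  apply: unif_bounded_sum => l; apply: unif_bounded_scale.
    by apply: unif_bounded_lin => //; exact: rV_coord_continuous.
  exact: partial_diff.
move=> i x; rewrite !deriveZB//.
rewrite (derive_equation Gr1)// (derive_equation Gr2)//.
under eq_bigr do rewrite rV_coordZB.
exact: linear_residual_split.
Qed.

End Families.

End SlowManifold.

(** * Uniform bounds and rates for the correction hierarchy *)

Section Corrections.
Context {R : realType} {nx ny : nat}.
Local Notation vx := 'rV[R]_nx.
Local Notation vy := 'rV[R]_ny.
Variables (f : vx * vy -> vx) (g : vx * vy -> vy) (K : nat) (b eps0 : R).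
Hypothesis f_smooth : smooth_bounded K f.
Hypothesis g_diff : forall z, differentiable g z.
Hypothesis g_smooth : forall v, smooth_bounded K (fun z => 'D_v g z).
Hypothesis b_gt0 : 0 < b.
Hypothesis g_diss : forall x y y',
  dot (g (x, y) - g (x, y')) (y - y') <= - b * enorm (y - y') ^+ 2.

Let e := prod_frame (rV_frame R nx) (rV_frame R ny).
Let I := {eps : R | 0 < eps <= eps0}.
Let G k (i : I) := Gamma f g k (val i).

(* [drift k] is the [r_k] with [g (x, Gamma_k x) = eps r_k x]. *)
Definition drift (k : nat) (eps : R) (x : vx) : vy :=
  match k with
  | 0%N => 0
  | j.+1 => 'd (Gamma f g j eps) x (f (x, Gamma f g j eps x))
  end.
Let r k (i : I) := drift k (val i).

Lemma Gamma_drift k eps x : g (x, Gamma f g k eps x) = eps *: drift k eps x.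
Proof.
case: k => [|k] /=; last exact: (solve_fastP g_diff g_smooth b_gt0 g_diss).
by rewrite scaler0 /gamma (solve_fastP g_diff g_smooth b_gt0 g_diss).
Qed.

Lemma f_comp_bounded k (h : I -> vx -> vy) : (k <= K)%N -> unif_smooth k h ->
  unif_bounded k (fun i x => f (x, h i x)).
Proof.
move=> kK /unif_smooth_graph; apply: (unif_bounded_comp e).
exact: unif_bounded_le kK (smooth_bounded_unif f_smooth).
Qed.

Lemma driftE k i x : differentiable (G k i) x ->
  r k.+1 i x =
  \sum_l rV_coord l (f (x, G k i x)) *: 'D_(delta_mx 0 l) (G k i) x.
Proof. by move=> dG; rewrite /r /= -deriveE// (derive_frame (rV_frame R nx)). Qed.

Lemma drift_bounded k m : (m <= K)%N -> unif_smooth m.+1 (G k) ->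
  unif_bounded m (r k.+1).
Proof.
move=> mK Gm; have [_ [dG DG]] := Gm.
rewrite (_ : r k.+1 = fun i x =>
  \sum_l rV_coord l (f (x, G k i x)) *: 'D_(delta_mx 0 l) (G k i) x); last first.
  by apply/funext => i; apply/funext => x; exact: driftE.
apply: unif_bounded_sum => l; apply: unif_bounded_scale => //.
apply: unif_bounded_lin; first exact: rV_coord_continuous.
by apply: f_comp_bounded => //; exact: unif_smoothW.
Qed.

Lemma unif_bounded_eps {V W : normedModType R} m (h : I -> V -> W) :
  unif_bounded m h -> unif_bounded m (fun i x => val i *: h i x).
Proof.
move=> hm; apply: (@unif_bounded_scale _ _ _ _ _ (fun i _ => val i)) => //.
apply: unif_bounded_cst; exists eps0 => i; have /andP[i0 ie] := valP i.
by rewrite gtr0_norm.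
Qed.

(** The factor [eps] in [g (x, Gamma_k) = eps r_k] is what gains one power of [eps] at each
    correction. *)
Lemma unif_bounded_rate {W : normedModType R} k m (h1 h2 : I -> vx -> W) :
  unif_bounded m (fun i x => (val i) ^- k *: (h1 i x - h2 i x)) ->
  unif_bounded m (fun i x => (val i) ^- k.+1 *: (val i *: h1 i x - val i *: h2 i x)).
Proof.
congr unif_bounded; apply/funext => i; apply/funext => x.
have /andP[i0 _] := valP i.
by rewrite -scalerBr scalerA exprSr invfM divfK ?gt_eqF.
Qed.

(** The three clauses feed each other: the rate of the drifts gives that of [Gamma_{k+1} - Gamma_k]
    with one more power of [eps], and this gives the next drift rate with one derivative less. The
    smoothness clauses bound the other factor of each product. *)
Lemma Gamma_bounds k : (k <= K)%N ->
  unif_smooth (K - k).+1 (G k) /\ unif_bounded (K - k) (r k.+1) /\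
  unif_bounded (K - k) (fun i x => (val i) ^- k *: (r k.+1 i x - r k i x)).
Proof.
have Gr j i x : g (x, G j i x) = val i *: r j i x by exact: Gamma_drift.
have solG j m : (m <= K)%N -> unif_smooth m.+1 (fun i x => val i *: r j i x) ->
    unif_smooth m.+1 (G j).
  move=> mK; exact: (solution_smooth g_diff g_smooth b_gt0 g_diss (Gr j) mK).
elim: k => [_|k IH kK].
  have r0 : unif_smooth K.+1 (fun i x => val i *: r 0 i x).
    apply/unif_bounded_smooth/unif_bounded_eps/unif_bounded_cst.
    by exists 0 => i; rewrite normr0.
  have G0 := solG _ _ (leqnn K) r0; have r1 := drift_bounded (leqnn K) G0.
  rewrite subn0; split=> //; split=> //.
  (* [drift 0] vanishes, so at [k = 0] the rate is just the bound on the first drift. *)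
  rewrite (_ : (fun _ _ => _) = r 1)//.
  by apply/funext => i; apply/funext => x; rewrite expr0 invr1 scale1r subr0.
have [Gk [rk dk]] := IH (ltnW kK).
have Km : (K - k = (K - k.+1).+1)%N by rewrite subnSK.
set m := (K - k.+1)%N in Km *; rewrite Km in Gk rk dk.
have mK : (m.+1 <= K)%N by rewrite -Km leq_subr.
have Gk1 : unif_smooth m.+1 (G k.+1).
  apply: solG; [exact: ltnW|].
  exact/unif_bounded_smooth/unif_bounded_eps.
have rk1 := drift_bounded (ltnW mK) Gk1.
split=> //; split=> //.
have delta : unif_bounded m.+1
    (fun i x => (val i) ^- k.+1 *: (G k.+1 i x - G k i x)).
  exact: (solution_diff_bounded g_diff g_smooth b_gt0 g_diss (Gr k.+1) (Gr k) mK
    Gk1 (unif_smoothW Gk) (unif_bounded_rate dk)).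
have fdelta : unif_bounded m (fun i x => (val i) ^- k.+1 *:
    (f (x, G k.+1 i x) - f (x, G k i x))).
  apply: (@unif_bounded_comp_diff _ _ _ _ e _ _ f
    (fun i x => (x, G k.+1 i x)) (fun i x => (x, G k i x))).
  - exact: unif_bounded_le mK (smooth_bounded_unif f_smooth).
  - exact/unif_smooth_graph/unif_smoothW.
  - exact/unif_smooth_graph/unif_smoothW/unif_smoothW.
  rewrite (_ : (fun _ _ => _) =
      fun i (x : vx) => ((0 : vx), (val i) ^- k.+1 *: (G k.+1 i x - G k i x))).
    apply: unif_bounded_pair; last exact: unif_boundedW.
    by apply: unif_bounded_cst; exists 0 => i; rewrite normr0.
  by apply/funext => i; apply/funext => x; congr (_, _); rewrite /= subrr scaler0.
have [_ [dGk DGk]] := Gk; have [_ [dGk1 DGk1]] := Gk1.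
have [_ [_ [_ Ddelta]]] := delta.
(* Product split of the difference of [D Gamma . f]: a difference of [f] against the derivative of
   the new [Gamma], plus the old [f] against the derivative of [delta]. *)
rewrite (_ : (fun _ _ => _) = fun i x => \sum_l
  (rV_coord l ((val i) ^- k.+1 *: (f (x, G k.+1 i x) - f (x, G k i x))) *:
     'D_(delta_mx 0 l) (G k.+1 i) x +
   rV_coord l (f (x, G k i x)) *:
     'D_(delta_mx 0 l) (fun z => (val i) ^- k.+1 *: (G k.+1 i z - G k i z)) x)).
  apply: unif_bounded_sum => l; apply: unif_boundedD; apply: unif_bounded_scale.
  - by apply: unif_bounded_lin => //; exact: rV_coord_continuous.
  - exact: DGk1.
  - apply: unif_bounded_lin; first exact: rV_coord_continuous.
    by apply: f_comp_bounded; [exact: ltnW|exact/unif_smoothW/unif_smoothW].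
  - exact: Ddelta.
apply/funext => i; apply/funext => x; rewrite !driftE//.
rewrite -sumrB scaler_sumr; apply: eq_bigr => l _.
rewrite deriveZ; last by apply: derivableB; exact: diff_derivable.
rewrite deriveB; [|exact: diff_derivable|exact: diff_derivable].
rewrite rV_coordZB.
move: (rV_coord l _) (rV_coord l _) ('D__ _ x) ('D__ _ x) => c1 c2 u1 u2.
by apply/rowP => j; rewrite !mxE; ring.
Qed.

End Corrections.

(** * Gronwall's inequality and the growth factor *)

Lemma within_continuous_comp {T U W : topologicalType} (A : set T) (h : T -> U)
    (F : U -> W) :
  {within A, continuous h} -> continuous F ->
  {within A, continuous (fun s => F (h s))}.
Proof.
move=> hc Fc s.
by have := @continuous_comp (subspace A) _ _ h F s (hc s) (Fc _).
Qed.

Lemma is_derive_comp1 {R : realType} (h F : R -> R) (x dh dF : R) :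
  is_derive x 1 h dh -> is_derive (h x) 1 F dF ->
  is_derive x 1 (fun z => F (h z)) (dF * dh).
Proof.
move=> [dh1 <-] [dF1 <-]; have dif1 := (derivable1_diffP h x).1 dh1.
have dif2 := (derivable1_diffP F (h x)).1 dF1.
apply: DeriveDef.
  exact/derivable1_diffP/(@differentiable_comp _ _ _ _ h F).
by have := derive1_comp dh1 dF1; rewrite !derive1E.
Qed.

Section SquaredNorm.
Context {R : realType} {n : nat}.

Let dotE {V : normedModType R} (h : V -> 'rV[R]_n) : (fun s => dot (h s) (h s)) =
  (fun s => \sum_i rV_coord i (h s) *: rV_coord i (h s)).
Proof. by []. Qed.

Lemma dot_continuous : continuous (fun u : 'rV[R]_n => dot u u).
Proof.
move=> u; apply: differentiable_continuous; rewrite (dotE id).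
have dc (i : 'I_n) : differentiable (fun s : 'rV[R]_n => rV_coord i s) u.
  by apply: linear_differentiable; exact: rV_coord_continuous.
by apply: differentiable_bigsum => i; exact: differentiable_scale.
Qed.

Lemma is_derive_dot (h : R -> 'rV[R]_n) (t : R) dh :
  is_derive t 1 h dh ->
  is_derive t 1 (fun s => dot (h s) (h s)) (2 * dot dh (h t)).
Proof.
move=> [d <-]; have dif : differentiable h t by exact/derivable1_diffP.
have dc (i : 'I_n) : differentiable (fun s => rV_coord i (h s)) t.
  by apply: differentiable_lin => //; exact: rV_coord_continuous.
rewrite dotE; apply: DeriveDef.
  apply/derivable1_diffP; apply: differentiable_bigsum => i.
  exact: differentiable_scale.
rewrite derive_bigsum => [|i]; last exact: differentiable_scale.
rewrite mulr_sumr; apply: eq_bigr => i _; rewrite derive_scale//.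
rewrite (derive_lin _ (@rV_coord_continuous _ _ i) dif).
by rewrite /rV_coord mulr2n mulrDl mul1r; congr (_ + _); exact: mulrC.
Qed.

End SquaredNorm.

Section Zeta.
Context {R : realType}.
Implicit Types lam t : R.

(** The value of the integral in [zeta], extended to every real [t] so that it can be differentiated
    in Gronwall's argument. *)
Definition exp_primitive lam t : R :=
  if lam == 0 then t else (expR (lam * t) - 1) / lam.

Lemma is_derive_expRM lam t :
  is_derive t 1 (fun s => expR (lam * s)) (expR (lam * t) * lam).
Proof.
apply: (is_derive_comp1 (h := fun s => lam * s)).
have := is_deriveZ lam (is_derive_id t 1).
by rewrite [_ *: _]mulr1.
Qed.

Lemma is_derive_exp_primitive lam t :
  is_derive t 1 (exp_primitive lam) (expR (lam * t)).
Proof.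
rewrite /exp_primitive; have [->|lam0] := eqVneq lam 0.
  by rewrite mul0r expR0; exact: is_derive_id.
have d := is_deriveB (is_derive_expRM lam t) (is_derive_cst (1 : R) t 1).
have -> : (fun s => (expR (lam * s) - 1) / lam) =
    lam^-1 \*: ((fun s => expR (lam * s)) - cst 1).
  by apply/funext => s /=; rewrite mulrC.
apply: is_derive_eq (is_deriveZ lam^-1 d) _.
by rewrite subr0 [LHS]mulrC mulfK.
Qed.

Lemma exp_primitive0 lam : exp_primitive lam 0 = 0.
Proof. by rewrite /exp_primitive mulr0 expR0 subrr mul0r if_same. Qed.

Lemma continuous_exp_primitive lam : continuous (exp_primitive lam).
Proof.
move=> t; apply/differentiable_continuous/derivable1_diffP.
by have [] := is_derive_exp_primitive lam t.
Qed.

Lemma continuous_expRM lam : continuous (fun s => expR (lam * s)).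
Proof.
move=> t; apply/differentiable_continuous/derivable1_diffP.
by have [] := is_derive_expRM lam t.
Qed.

Lemma zetaE lam t : 0 <= t -> zeta lam t = exp_primitive lam t.
Proof.
rewrite le_eqVlt => /predU1P[<-|t_gt0].
  by rewrite /zeta set_itv1 Rintegral_set1 exp_primitive0.
rewrite /zeta /Rintegral.
rewrite (@continuous_FTC2 _ (fun s => expR (lam * s)) (exp_primitive lam))//.
- by rewrite exp_primitive0 /= subr0.
- by apply: continuous_subspaceT; exact: continuous_expRM.
- split.
  + by move=> x _; have [] := is_derive_exp_primitive lam x.
  + apply: cvg_at_right_filter; exact: continuous_exp_primitive.
  + apply: cvg_at_left_filter; exact: continuous_exp_primitive.
- by move=> x _; rewrite derive1E; have [] := is_derive_exp_primitive lam x.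
Qed.

(** The reflection [s -> t - s] in the integral; it removes the weight [expR (- lam * t)] at the end
    of Gronwall's argument. *)
Lemma expRM_exp_primitive lam t :
  expR (lam * t) * exp_primitive (- lam) t = exp_primitive lam t.
Proof.
rewrite /exp_primitive oppr_eq0; have [->|lam0] := eqVneq lam 0.
  by rewrite mul0r expR0 mul1r.
rewrite mulNr invrN mulrN -mulNr opprB mulrA mulrBr mulr1.
by rewrite -expRD subrr expR0.
Qed.

Lemma exp_primitive_ge0 lam t : 0 <= t -> 0 <= exp_primitive lam t.
Proof.
move=> t_ge0; rewrite /exp_primitive; case: eqVneq => // lam0.
have [l_gt0|l_le0] := ltP 0 lam.
  apply: divr_ge0; last exact: ltW.
  by rewrite subr_ge0 -expR0 ler_expR mulr_ge0// ltW.
apply: mulr_le0; last by rewrite invr_le0.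
by rewrite subr_le0 -expR0 ler_expR mulr_le0_ge0.
Qed.

(** The right-hand side is the length of [[0, t]] times the maximum of the integrand; both signs of
    [lam] reduce to [1 + x <= expR x]. *)
Lemma exp_primitive_le lam t : 0 <= t ->
  exp_primitive lam t <= expR (Num.max 0 (lam * t)) * t.
Proof.
move=> t_ge0; rewrite /exp_primitive; have [->|lam0] := eqVneq lam 0.
  by rewrite mul0r maxxx expR0 mul1r.
have [l_gt0|l_le0] := ltP 0 lam.
  have -> : Num.max 0 (lam * t) = lam * t.
    by apply/max_idPr; rewrite mulr_ge0// ltW.
  rewrite ler_pdivrMr//.
  have := expR_ge1Dx (- (lam * t)); rewrite expRN.
  have E_gt0 := expR_gt0 (lam * t).
  move/(ler_wpM2l (ltW E_gt0)); rewrite divff ?gt_eqF//; lra.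
have {}l_le0 : lam < 0 by rewrite lt_neqAle lam0.
have -> : Num.max 0 (lam * t) = 0 by apply/max_idPl; rewrite mulr_le0_ge0// ltW.
rewrite expR0 mul1r ler_ndivrMr//.
have := expR_ge1Dx (lam * t); lra.
Qed.

(** The bound is the integral of the decaying exponential over the whole half-line. *)
Lemma exp_primitive_le_inv lam t : lam < 0 -> exp_primitive lam t <= (- lam)^-1.
Proof.
move=> l_lt0; rewrite /exp_primitive lt_eqF// ler_ndivrMr//.
by rewrite invrN mulNr mulVf ?lt_eqF// lerBrDr addNr expR_ge0.
Qed.

End Zeta.

(** The norm is not differentiable where [h] vanishes, so the weighted norm is replaced by the
    square root of its square plus [d ^+ 2]. After subtracting the integrated forcing it is
    nonincreasing, and [d] is then sent to 0. *)
Lemma gronwall {R : realType} {n : nat} (h dh : R -> 'rV[R]_n) (lam eta : R) :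
  0 <= eta -> {within `[0, +oo[, continuous h} ->
  (forall t : R, 0 < t -> is_derive t 1 h (dh t)) ->
  (forall t : R, 0 < t ->
     dot (dh t) (h t) <= lam * enorm (h t) ^+ 2 + eta * enorm (h t)) ->
  forall t : R, 0 <= t ->
    enorm (h t) <= expR (lam * t) * enorm (h 0) + eta * exp_primitive lam t.
Proof.
move=> eta_ge0 hc hd hle t t_ge0.
pose E (s : R) : R := expR (- (2 * lam) * s).
suff key (d : R) : 0 < d -> expR (- lam * t) * enorm (h t) <=
    enorm (h 0) + eta * exp_primitive (- lam) t + d.
  have : expR (- lam * t) * enorm (h t) <= enorm (h 0) + eta * exp_primitive (- lam) t.
    by apply/ler_addgt0Pr.
  move/(ler_wpM2l (expR_ge0 (lam * t))).
  rewrite mulrA -expRD mulNr subrr expR0 mul1r mulrDr.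
  by rewrite (mulrCA _ eta) expRM_exp_primitive.
move=> d_gt0.
pose q (s : R) : R := E s * dot (h s) (h s) + d ^+ 2.
have q_gt0 (s : R) : 0 < q s.
  by rewrite ltr_wpDl ?exprn_gt0// mulr_ge0 ?expR_ge0// dot_ge0.
have EE (s : R) : E s = expR (- lam * s) ^+ 2.
  by rewrite /E -expRM_natl; congr expR; ring.
have qE (s : R) : q s = (expR (- lam * s) * enorm (h s)) ^+ 2 + d ^+ 2.
  by rewrite exprMn sqr_enorm -EE.
pose W (s : R) : R := Num.sqrt (q s) - eta * exp_primitive (- lam) s.
have leq_sqrtq (s : R) : expR (- lam * s) * enorm (h s) <= Num.sqrt (q s).
  rewrite -[leLHS]ger0_norm ?mulr_ge0 ?expR_ge0 ?enorm_ge0// -sqrtr_sqr.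
  by rewrite ler_wsqrtr// qE lerDl sqr_ge0.
have dW (s : R) : 0 < s -> is_derive s 1 W
    ((2 * Num.sqrt (q s))^-1 *
       (E s * (2 * dot (dh s) (h s)) + dot (h s) (h s) * (E s * - (2 * lam))) -
     eta * expR (- lam * s)).
  move=> s_gt0.
  have d1 := is_derive_dot (hd s s_gt0).
  have d2 := is_derive_expRM (- (2 * lam)) s.
  have d3 := is_deriveD (is_deriveM d2 d1) (is_derive_cst (d ^+ 2) s 1).
  have d4 := is_derive_comp1 d3 (is_derive1_sqrt (q_gt0 s)).
  have d5 := is_deriveZ eta (is_derive_exp_primitive (- lam) s).
  by have := is_deriveB d4 d5; rewrite addr0; apply.
have W_noninc : W t <= W 0.
  apply: (@ler0_derive1_nincry _ W 0) => //.
  - by move=> s; rewrite in_itv/= andbT => /dW [].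
  - move=> s; rewrite in_itv/= andbT => s_gt0.
    rewrite derive1E; have [_ ->] := dW s s_gt0.
    have sq_gt0 : 0 < Num.sqrt (q s) by rewrite sqrtr_gt0.
    (* The derivative of the weight cancels the [lam] term; what remains of the forcing is bounded
       because the weighted norm is at most [Num.sqrt (q s)]. *)
    rewrite subr_le0 ler_pdivrMl ?mulr_gt0// -sqr_enorm.
    have h1 := hle s s_gt0.
    have h2 : eta * (expR (- lam * s) * enorm (h s)) <= eta * Num.sqrt (q s).
      by rewrite ler_wpM2l.
    have h3 := expR_gt0 (- lam * s); rewrite EE.
    set x := expR (- lam * s) in h2 h3 *.
    have h4 : x ^+ 2 * dot (dh s) (h s) <=
        x ^+ 2 * (lam * enorm (h s) ^+ 2 + eta * enorm (h s)).
      by rewrite ler_wpM2l// sqr_ge0.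
    have h5 : x * (eta * (x * enorm (h s))) <= x * (eta * Num.sqrt (q s)).
      by rewrite ler_wpM2l// ltW.
    lra.
  - have dc : {within `[0, +oo[, continuous (fun s => dot (h s) (h s))}.
      exact: (within_continuous_comp hc (@dot_continuous _ _)).
    have Ec : {within `[0, +oo[, continuous E}.
      exact: (continuous_subspaceT (@continuous_expRM _ _)).
    have qc : {within `[0, +oo[, continuous q}.
      move=> s; exact: continuousD (continuousM (Ec s) (dc s)) (@cst_continuous _ _ _ _).
    have sc : {within `[0, +oo[, continuous (fun s => Num.sqrt (q s))}.
      exact: (within_continuous_comp qc (@sqrt_continuous _)).
    have Pc : {within `[0, +oo[, continuous (exp_primitive (- lam))}.
      exact: (continuous_subspaceT (@continuous_exp_primitive _ _)).
    move=> s.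
    exact: continuousB (sc s) (continuousM (@cst_continuous _ _ eta _) (Pc s)).
have W0 : W 0 <= enorm (h 0) + d.
  rewrite /W exp_primitive0 mulr0 subr0 qE mulr0 expR0 mul1r.
  have nd : 0 <= enorm (h 0) + d by rewrite addr_ge0 ?enorm_ge0// ltW.
  rewrite -[leRHS]ger0_norm// -sqrtr_sqr ler_wsqrtr// sqrrD lerD2r lerDl.
  by rewrite mulrn_wge0// mulr_ge0 ?enorm_ge0// ltW.
rewrite (le_trans (leq_sqrtq t))//.
have := le_trans W_noninc W0; rewrite /W; lra.
Qed.

(** * Error estimate *)

Lemma is_derive_lin {R : realType} {V W : normedModType R} (L : {linear V -> W})
    (h : R -> V) (t : R) (dh : V) :
  continuous L -> is_derive t 1 h dh -> is_derive t 1 (fun s => L (h s)) (L dh).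
Proof.
move=> Lc [d <-]; have dif : differentiable h t by exact/derivable1_diffP.
apply: DeriveDef; last exact: derive_lin.
exact/derivable1_diffP/differentiable_lin.
Qed.

Lemma is_derive_fst {R : realType} {V W : normedModType R} (h : R -> V * W)
    (t : R) (dh : V * W) :
  is_derive t 1 h dh -> is_derive t 1 (fun s => (h s).1) dh.1.
Proof. by apply: (is_derive_lin (L := fst)) => q; exact: cvg_fst. Qed.

Lemma is_derive_snd {R : realType} {V W : normedModType R} (h : R -> V * W)
    (t : R) (dh : V * W) :
  is_derive t 1 h dh -> is_derive t 1 (fun s => (h s).2) dh.2.
Proof. by apply: (is_derive_lin (L := snd)) => q; exact: cvg_snd. Qed.

Section OneSidedLipschitz.
Context {R : realType} {n : nat}.
Implicit Types (F : 'rV[R]_n -> 'rV[R]_n) (lam L t : R).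

(** The Lipschitz bound enters only through finiteness: it bounds the set of quotients above, so
    that the real [sup] is a true upper bound. *)
Lemma one_sided_lipschitzP F L :
  (forall x y, enorm (F x - F y) <= L * enorm (x - y)) ->
  forall x y, dot (F x - F y) (x - y) <= one_sided_lipschitz F * enorm (x - y) ^+ 2.
Proof.
move=> FL x y; have [->|xy] := eqVneq x y.
  by rewrite !subrr enorm0 expr0n mulr0 dot0l.
have e_gt0 : 0 < enorm (x - y).
  rewrite lt_neqAle enorm_ge0 andbT eq_sym.
  by apply: contraNneq xy => /enorm_eq0/subr0_eq ->.
rewrite -ler_pdivrMr ?exprn_gt0//; apply: sup_ubound; last by exists x, y.
exists L => _ [u [v [uv ->]]].
have u_gt0 : 0 < enorm (u - v).
  rewrite lt_neqAle enorm_ge0 andbT eq_sym.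
  by apply: contraNneq uv => /enorm_eq0/subr0_eq ->.
rewrite ler_pdivrMr ?exprn_gt0// (le_trans (dot_le_enorm _ _))//.
by rewrite expr2 mulrA ler_wpM2r ?enorm_ge0.
Qed.

Lemma lipschitz_flow F lam t :
  (forall x y, dot (F x - F y) (x - y) <= lam * enorm (x - y) ^+ 2) ->
  0 <= t -> lipschitz_flow_at F (expR (lam * t)) t.
Proof.
move=> Flam t_ge0 X1 X2 [c1 d1] [c2 d2].
have := @gronwall _ _ (fun s => X1 s - X2 s) (fun s => F (X1 s) - F (X2 s)) lam 0
  (lexx 0) _ _ _ t t_ge0.
move=> h; apply: le_trans (h _ _ _) _ => {h}.
- move=> s; exact: continuousB (c1 s) (c2 s).
- by move=> s s_gt0; exact: is_deriveB (d1 s s_gt0) (d2 s s_gt0).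
- by move=> s s_gt0; rewrite mul0r addr0.
- by rewrite mul0r addr0.
Qed.

Lemma lipschitz_flow_atW F L L' t :
  L <= L' -> lipschitz_flow_at F L t -> lipschitz_flow_at F L' t.
Proof.
move=> LL' FL X1 X2 s1 s2; rewrite (le_trans (FL _ _ s1 s2))//.
by rewrite ler_wpM2r ?enorm_ge0.
Qed.

End OneSidedLipschitz.

Section ErrorEstimate.
Context {R : realType} {nx ny : nat}.
Local Notation vx := 'rV[R]_nx.
Local Notation vy := 'rV[R]_ny.
Variables (f : vx * vy -> vx) (g : vx * vy -> vy) (K : nat) (b eps0 : R).
Hypothesis f_smooth : smooth_bounded K f.
Hypothesis g_diff : forall z, differentiable g z.
Hypothesis g_smooth : forall v, smooth_bounded K (fun z => 'D_v g z).
Hypothesis b_gt0 : 0 < b.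
Hypothesis g_diss : forall x y y',
  dot (g (x, y) - g (x, y')) (y - y') <= - b * enorm (y - y') ^+ 2.
Variable k : nat.
Hypothesis kK : (k < K)%N.

Lemma f_bound : exists M, forall z, `|f z| <= M.
Proof.
have := unif_bounded_le (leq0n K) (smooth_bounded_unif (I := unit) f_smooth).
by move=> [_ [[M hM] _]]; exists M; exact: hM.
Qed.

Lemma f_lipschitz : exists2 L, 0 <= L & forall z z', `|f z - f z'| <= L * `|z - z'|.
Proof.
have := unif_bounded_le (leq_ltn_trans (leq0n k) kK)
  (smooth_bounded_unif (I := unit) f_smooth).
move=> [_ [_ [df Df]]].
have [|L L_ge0 hL] :=
    ler_derive_frame (prod_frame (rV_frame R nx) (rV_frame R ny)) df.
  by move=> v; have [_ [+ _]] := Df v.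
by exists L => // z z'; exact: (mean_value_le (df tt) (hL tt)).
Qed.

Lemma Gamma_differentiable eps x : 0 < eps <= eps0 ->
  differentiable (Gamma f g k eps) x.
Proof.
move=> heps.
have [[_ [dG _]] _] := Gamma_bounds eps0 f_smooth g_diff g_smooth b_gt0 g_diss (ltnW kK).
exact: (dG (exist _ eps heps)).
Qed.

Lemma Gamma_derive_bound : exists2 C, 0 <= C &
  forall eps x v, 0 < eps <= eps0 -> `|'D_v (Gamma f g k eps) x| <= C * `|v|.
Proof.
have [[_ [dG DG]] _] := Gamma_bounds eps0 f_smooth g_diff g_smooth b_gt0 g_diss (ltnW kK).
have [|C C_ge0 hC] := ler_derive_frame (rV_frame R nx) dG.
  by move=> v; have [_ [+ _]] := unif_bounded_le (leq0n _) (DG v).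
by exists C => // eps x v heps; exact: (hC (exist _ eps heps)).
Qed.

Lemma drift_rate : exists2 C, 0 <= C & forall eps x, 0 < eps <= eps0 ->
  `|drift f g k.+1 eps x - drift f g k eps x| <= C * eps ^+ k.
Proof.
have [_ [_ rk]] := Gamma_bounds eps0 f_smooth g_diff g_smooth b_gt0 g_diss (ltnW kK).
have [_ [[M hM] _]] := unif_bounded_le (leq0n _) rk.
exists `|M| => // eps x heps; have /andP[eps_gt0 _] := heps.
have := hM (exist _ eps heps) x; rewrite /= normrZ gtr0_norm ?invr_gt0 ?exprn_gt0//.
rewrite ler_pdivrMl ?exprn_gt0// => /le_trans; apply.
by rewrite mulrC ler_wpM2r ?ler_norm// exprn_ge0// ltW.
Qed.

(** This makes the supremum defining [lambda_k] finite; growth is measured by [lambda_k], not by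
    [L]. *)
Lemma corrected_field_lipschitz eps : 0 < eps <= eps0 ->
  exists L, forall x y, enorm (corrected_field f g k eps x -
    corrected_field f g k eps y) <= L * enorm (x - y).
Proof.
move=> heps; have [L L_ge0 hL] := f_lipschitz.
have [C C_ge0 hC] := Gamma_derive_bound.
exists (nx%:R * (L * (1 + C))) => x y; rewrite (le_trans (enorm_le_norm _))//.
rewrite -mulrA ler_wpM2l// (le_trans (hL _ _))// -mulrA ler_wpM2l//.
have xy := norm_le_enorm (x - y).
have e_ge0 := enorm_ge0 (x - y).
have := mean_value_le (fun x => Gamma_differentiable x heps)
   (fun x v => hC eps x v heps) x y.
rewrite prod_normE/= ge_max => h; apply/andP; split.
  by rewrite mulrDl mul1r (le_trans xy)// lerDl mulr_ge0.
rewrite (le_trans h)// (le_trans (ler_wpM2l C_ge0 xy))//.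
by rewrite mulrDl mul1r lerDr.
Qed.

(* Far from [eps = 0] the boundedness of [f], rather than its Lipschitz
   continuity, controls the feedback of the fast variable. *)
Lemma slow_manifold_dissipative : exists2 C, 0 <= C &
  forall eps x y, 0 < eps <= eps0 ->
    dot (eps^-1 *: g (x, y) - 'D_(f (x, y)) (Gamma f g k eps) x)
        (y - Gamma f g k eps x) <=
    - (b / (2 * eps)) * enorm (y - Gamma f g k eps x) ^+ 2 +
    C * eps ^+ k * enorm (y - Gamma f g k eps x).
Proof.
have [L L_ge0 hL] := f_lipschitz; have [M hM] := f_bound.
have M_ge0 : 0 <= M := le_trans (normr_ge0 _) (hM 0).
have [CG CG_ge0 hCG] := Gamma_derive_bound.
have [Cr Cr_ge0 hCr] := drift_rate.
pose c1 : R := ny%:R * CG * L.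
have c1_ge0 : 0 <= c1 by rewrite !mulr_ge0.
(* Below [eps1] the feedback constant [c1] is at most [b / (2 * eps)], so it consumes at most half
   of the contraction. *)
pose eps1 : R := b / (2 * (c1 + 1)).
have eps1_gt0 : 0 < eps1 by rewrite divr_gt0// mulr_gt0// ltr_wpDl.
pose c2 : R := ny%:R * CG * (2 * M).
have c2_ge0 : 0 <= c2 by rewrite !mulr_ge0.
exists (ny%:R * Cr + c2 / eps1 ^+ k).
  by rewrite addr_ge0 ?mulr_ge0// invr_ge0 exprn_ge0// ltW.
move=> eps x y heps; have /andP[eps_gt0 _] := heps.
set G := Gamma f g k eps; set z := y - G x.
have dG : differentiable G x by exact: Gamma_differentiable.
have gG : eps^-1 *: g (x, G x) = drift f g k eps x.
  rewrite (Gamma_drift f g_diff g_smooth b_gt0 g_diss) scalerA.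
  by rewrite mulVf ?gt_eqF// scale1r.
have dS : drift f g k.+1 eps x = 'D_(f (x, G x)) G x by rewrite deriveE.
have dD : 'D_(f (x, y) - f (x, G x)) G x =
    'D_(f (x, y)) G x - 'D_(f (x, G x)) G x by rewrite !deriveE// linearB.
have -> : eps^-1 *: g (x, y) - 'D_(f (x, y)) G x =
    eps^-1 *: (g (x, y) - g (x, G x)) - (drift f g k.+1 eps x - drift f g k eps x) -
    'D_(f (x, y) - f (x, G x)) G x.
  rewrite scalerBr gG dS dD.
  move: ('D_(f (x, y)) G x) ('D_(f (x, G x)) G x) (drift f g k eps x) => p1 p2 p3.
  by apply/rowP => j; rewrite !mxE; ring.
rewrite 2!dotBl dotZl.
have e_ge0 := enorm_ge0 z.
have h1 : eps^-1 * dot (g (x, y) - g (x, G x)) z <= - (b / eps) * enorm z ^+ 2.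
  rewrite mulrC -[leRHS](_ : (- b * enorm z ^+ 2) / eps = _); last by ring.
  by rewrite ler_wpM2r ?invr_ge0 ?(ltW eps_gt0)// g_diss.
have h2 : - dot (drift f g k.+1 eps x - drift f g k eps x) z <=
    ny%:R * Cr * eps ^+ k * enorm z.
  rewrite -dotNl (le_trans (dot_le_enorm _ _))// enormN ler_wpM2r//.
  by rewrite (le_trans (enorm_le_norm _))// -mulrA ler_wpM2l// hCr.
set D := 'D_ _ G x.
have D_le : enorm D <= ny%:R * CG * `|f (x, y) - f (x, G x)|.
  by rewrite (le_trans (enorm_le_norm _))// -mulrA ler_wpM2l// hCG.
have h3 : - dot D z <= enorm D * enorm z.
  by rewrite -dotNl (le_trans (dot_le_enorm _ _))// enormN.
have eps1_k : 0 < eps1 ^+ k by rewrite exprn_gt0.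
have [eps_le|eps_gt] := leP eps eps1.
  have h4 : enorm D <= c1 * enorm z.
    rewrite (le_trans D_le)// /c1 -[leRHS]mulrA ler_wpM2l ?mulr_ge0//.
    rewrite (le_trans (hL _ _))// ler_wpM2l// prod_normE/= subrr normr0.
    by rewrite (max_idPr _)// norm_le_enorm.
  have h5 : c1 <= b / (2 * eps).
    rewrite ler_pdivlMr ?mulr_gt0//.
    have : eps * (2 * (c1 + 1)) <= b.
      by rewrite -ler_pdivlMr// mulr_gt0// ltr_wpDl.
    nra.
  have h6 : enorm D * enorm z <= b / (2 * eps) * enorm z ^+ 2.
    by rewrite expr2 mulrA ler_wpM2r// (le_trans h4)// ler_wpM2r.
  have h7 : b / eps = b / (2 * eps) + b / (2 * eps) by field; rewrite gt_eqF.
  have h8 : 0 <= c2 / eps1 ^+ k * eps ^+ k * enorm z.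
    by rewrite !mulr_ge0 ?invr_ge0 ?exprn_ge0// ltW.
  rewrite h7 in h1; move: (b / _) (c2 / _) (eps^-1 * _) h1 h6 h8 => u w p h1 h6 h8.
  lra.
(* For [eps > eps1] the plain bound [c2] is already of order [eps ^+ k], since
   [(eps / eps1) ^+ k >= 1]. *)
have h4 : enorm D <= c2 / eps1 ^+ k * eps ^+ k.
  apply: (@le_trans _ _ c2).
    rewrite (le_trans D_le)// ler_wpM2l ?mulr_ge0//.
    rewrite (le_trans (ler_normB _ _))//.
    have := hM (x, y); have := hM (x, G x); lra.
  rewrite -mulrA ler_peMr// ler_pdivlMl// mulr1 lerXn2r// ?nnegrE ltW//.
have h5 : enorm D * enorm z <= c2 / eps1 ^+ k * eps ^+ k * enorm z.
  by rewrite ler_wpM2r.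
have h7 : b / eps = b / (2 * eps) + b / (2 * eps) by field; rewrite gt_eqF.
have h8 : 0 <= b / (2 * eps) * enorm z ^+ 2.
  by rewrite mulr_ge0 ?sqr_ge0// divr_ge0// ?mulr_ge0// ltW.
rewrite h7 in h1; move: (b / _) (c2 / _) (eps^-1 * _) h1 h5 h8 => u w p h1 h5 h8.
lra.
Qed.

(** The forcing is only [C * eps ^+ k]; the last power of [eps] comes from integrating it against
    the decay rate [b / (2 * eps)]. The constant adds the initial distance and this contribution
    [2 * C / b]. *)
Lemma slow_manifold_attracts (C0 : R) : exists2 C, 0 <= C &
  forall eps (Z : R -> vx * vy), 0 < eps <= eps0 -> solves (fast_slow f g eps) Z ->
    enorm ((Z 0).2 - Gamma f g k eps (Z 0).1) <= C0 * eps ^+ k.+1 ->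
    forall t, 0 <= t ->
      enorm ((Z t).2 - Gamma f g k eps (Z t).1) <= C * eps ^+ k.+1.
Proof.
have [C C_ge0 hC] := slow_manifold_dissipative.
exists (`|C0| + 2 * C / b); first by rewrite addr_ge0// divr_ge0 ?mulr_ge0// ltW.
move=> eps Z heps [Zc Zd] Z0 t t_ge0; have /andP[eps_gt0 _] := heps.
set G := Gamma f g k eps in Z0 *.
have dG x : differentiable G x by exact: Gamma_differentiable.
have lam_lt0 : - (b / (2 * eps)) < 0 by rewrite oppr_lt0 divr_gt0// mulr_gt0.
have := @gronwall _ _ (fun s => (Z s).2 - G (Z s).1)
  (fun s => eps^-1 *: g (Z s) - 'D_(f (Z s)) G (Z s).1)
  (- (b / (2 * eps))) (C * eps ^+ k) _ _ _ _ t t_ge0.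
move=> h; apply: le_trans (h _ _ _ _) _ => {h}.
- by rewrite mulr_ge0// exprn_ge0// ltW.
- have Fc : continuous (fun q : vx * vy => q.2 - G q.1).
    move=> q; apply/differentiable_continuous/differentiableB.
      exact: differentiable_snd.
    apply: (@differentiable_comp _ _ _ _ fst G) => //.
    exact: differentiable_fst.
  by have := within_continuous_comp Zc Fc.
- move=> s s_gt0; have dZ := Zd s s_gt0.
  have d1 : is_derive s 1 (fun s => (Z s).1) (f (Z s)).
    exact: is_derive_fst dZ.
  have d2 : is_derive s 1 (fun s => (Z s).2) (eps^-1 *: g (Z s)).
    exact: is_derive_snd dZ.
  have [d1d d1E] := d1; have d1' : differentiable (fun s => (Z s).1) s.
    exact/derivable1_diffP.
  have d3 : is_derive s 1 (fun s => G (Z s).1) ('D_(f (Z s)) G (Z s).1).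
    apply: DeriveDef.
      apply/derivable1_diffP.
      exact: (@differentiable_comp _ _ _ _ (fun s => (Z s).1) G).
    by rewrite (derive_comp_lin _ d1' (dG _)) d1E.
  exact: is_deriveB d2 d3.
- by move=> s s_gt0; have := hC eps (Z s).1 (Z s).2 heps; rewrite -surjective_pairing.
rewrite [leRHS]mulrDl lerD//.
  apply: (@le_trans _ _ (1 * enorm ((Z 0).2 - G (Z 0).1))).
    by rewrite ler_wpM2r ?enorm_ge0// expR_le1 mulr_le0_ge0// ltW.
  rewrite mul1r (le_trans Z0)// ler_wpM2r ?ler_norm//.
  by rewrite exprn_ge0// ltW.
have := exp_primitive_le_inv t lam_lt0; rewrite opprK.
move/(ler_wpM2l (mulr_ge0 C_ge0 (exprn_ge0 k (ltW eps_gt0))))/le_trans; apply.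
rewrite invf_div exprS le_eqVlt; apply/orP; left; apply/eqP.
by field; rewrite gt_eqF.
Qed.

Lemma error_estimate (C0 : R) : exists2 C, 0 < C &
  forall eps (Z : R -> vx * vy) (X : R -> vx), 0 < eps <= eps0 ->
    solves (fast_slow f g eps) Z -> solves (corrected_field f g k eps) X ->
    X 0 = (Z 0).1 ->
    enorm ((Z 0).2 - Gamma f g k eps (Z 0).1) <= C0 * eps ^+ k.+1 ->
    forall t, 0 <= t -> enorm ((Z t).1 - X t) <=
      C * eps ^+ k.+1 * zeta (one_sided_lipschitz (corrected_field f g k eps)) t.
Proof.
have [C C_ge0 hC] := slow_manifold_attracts C0.
have [L L_ge0 hL] := f_lipschitz.
exists (nx%:R * L * C + 1); first by rewrite ltr_wpDl// !mulr_ge0.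
move=> eps Z X heps sZ [Xc Xd] X0 Z0 t t_ge0; have /andP[eps_gt0 _] := heps.
have {}hC := hC eps Z heps sZ Z0; have [Zc Zd] := sZ.
have [LF hLF] := corrected_field_lipschitz heps.
set G := Gamma f g k eps in hC; set lam := one_sided_lipschitz _.
have ek_ge0 : 0 <= eps ^+ k.+1 by rewrite exprn_ge0// ltW.
have := @gronwall _ _ (fun s => (Z s).1 - X s)
  (fun s => f (Z s) - corrected_field f g k eps (X s))
  lam (nx%:R * L * C * eps ^+ k.+1) _ _ _ _ t t_ge0.
rewrite X0 subrr enorm0 mulr0 add0r zetaE// => h.
apply: le_trans (h _ _ _ _) _ => {h}.
- by rewrite !mulr_ge0.
- have Z1c : {within `[0, +oo[, continuous (fun s => (Z s).1)}.
    have Fc : continuous (fst : vx * vy -> vx) by move=> q; exact: cvg_fst.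
    by have := within_continuous_comp Zc Fc.
  move=> s; exact: continuousB (Z1c s) (Xc s).
- move=> s s_gt0; apply: is_deriveB (Xd s s_gt0).
  exact: is_derive_fst (Zd s s_gt0).
- move=> s s_gt0.
  (* The model field at the true slow variable is inserted: [lambda_k] governs its difference with
     the field at [X s], and attraction to the slow manifold bounds the rest. *)
  have -> : f (Z s) - corrected_field f g k eps (X s) =
      (corrected_field f g k eps (Z s).1 - corrected_field f g k eps (X s)) +
      (f (Z s) - f ((Z s).1, G (Z s).1)).
    by rewrite [RHS]addrC [RHS]addrA /corrected_field -/G subrK.
  rewrite dotDl lerD//; first exact: one_sided_lipschitzP hLF _ _.
  rewrite (le_trans (dot_le_enorm _ _))// ler_wpM2r ?enorm_ge0//.
  rewrite (le_trans (enorm_le_norm _))// -!mulrA ler_wpM2l//.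
  rewrite (le_trans (hL _ _))// ler_wpM2l//.
  rewrite [Z s]surjective_pairing prod_normE/= subrr normr0 (max_idPr _)//.
  by rewrite (le_trans (norm_le_enorm _))// hC// ltW.
rewrite ler_wpM2r ?exp_primitive_ge0// ler_wpM2r// lerDl//.
Qed.

End ErrorEstimate.

(** * Assembly of the error estimate, the stability horizon and the growth regimes *)

Theorem theorem3p4 (R : realType) (nx ny : nat)
  (f : 'rV[R]_nx * 'rV[R]_ny -> 'rV[R]_nx)
  (g : 'rV[R]_nx * 'rV[R]_ny -> 'rV[R]_ny)
  (K : nat) (beta eps0 A : R)
  (* full flow, and its maximal stability time *)
  (Phi : R -> R -> 'rV[R]_nx * 'rV[R]_ny -> 'rV[R]_nx * 'rV[R]_ny)
  (Tfull : R -> \bar R)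
  (k : nat)
  (x0 : R -> 'rV[R]_nx) (y0 : R -> 'rV[R]_ny)
  (X : R -> R -> 'rV[R]_nx) :
  (0 < nx)%N -> (0 < ny)%N -> 0 < eps0 ->
  (* regularity *)
  (0 < K)%N ->
  smooth_bounded K f ->
  (forall z, differentiable g z) ->
  (forall v, smooth_bounded K (fun z => 'D_v g z)) ->
  (* rapid dissipation *)
  0 < beta ->
  (forall x y y', dot (g (x, y) - g (x, y')) (y - y')
                    <= - beta * enorm (y - y') ^+ 2) ->
  (* long-time stability of the full system *)
  0 < A ->
  (forall eps, 0 < eps <= eps0 ->
     is_flow (fast_slow f g eps) (Phi eps) /\
     (0 < Tfull eps)%E /\
     forall t, 0 <= t -> (t%:E <= Tfull eps)%E ->
       forall z, differentiable (Phi eps t) z /\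
         forall v, `|'d (Phi eps t) z v| <= A * `|v|) ->
  (* mild growth *)
  one_sided_lipschitz (fun x => f (x, gamma g x)) <= 0 ->
  (* the k-th order model, and well-prepared initial data *)
  (k <= K - 1)%N ->
  (forall eps, 0 < eps <= eps0 ->
     solves (corrected_field f g k eps) (X eps) /\ X eps 0 = x0 eps) ->
  (exists C0 : R, forall eps, 0 < eps <= eps0 ->
     enorm (y0 eps - Gamma f g k eps (x0 eps)) <= C0 * eps ^+ k.+1) ->
  let lam eps := one_sided_lipschitz (corrected_field f g k eps) in
  let x eps t := (Phi eps t (x0 eps, y0 eps)).1 in
  (* error estimate *)
  (exists C : R, 0 < C /\ forall eps, 0 < eps <= eps0 -> forall t, 0 <= t ->
     enorm (x eps t - X eps t) <= C * eps ^+ k.+1 * zeta (lam eps) t)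
  /\
  (* stability horizon of the k-th order model *)
  (forall c : R, 0 < c -> exists L : R, 0 < L /\
     forall eps, 0 < eps <= eps0 ->
     forall t, 0 <= t -> (t%:E <= stability_horizon c (lam eps))%E ->
       lipschitz_flow_at (corrected_field f g k eps) L t)
  /\
  (* (i) *)
  (forall m c : R, 0 < c ->
     (forall eps, 0 < eps <= eps0 -> lam eps <= c * eps `^ m) ->
     forall a : R, 0 < a -> exists C : R, 0 < C /\
     forall eps, 0 < eps <= eps0 -> forall t, 0 <= t <= a * eps `^ (- m) ->
       zeta (lam eps) t <= C * t /\
       lipschitz_flow_at (corrected_field f g k eps) C t)
  /\
  (* (ii) *)
  (forall eps, 0 < eps <= eps0 -> lam eps <= 0 ->
     forall t, 0 <= t -> zeta (lam eps) t <= t)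
  /\
  (* (iii) *)
  (forall m c : R, 0 < c ->
     (forall eps, 0 < eps <= eps0 -> lam eps <= - c * eps `^ m) ->
     exists C : R, 0 < C /\
     forall eps, 0 < eps <= eps0 -> forall t, 0 <= t ->
       zeta (lam eps) t <= C * Num.min t (eps `^ (- m))).
Proof.
move=> nx_gt0 ny_gt0 eps0_gt0 K_gt0 f_smooth g_diff g_smooth b_gt0 g_diss A_gt0.
move=> full_flow _ kK X_sol [C0 prepared] lam x.
have {}kK : (k < K)%N by rewrite (leq_ltn_trans kK)// ltn_subrL.
have lamP eps : 0 < eps <= eps0 -> forall u v,
    dot (corrected_field f g k eps u - corrected_field f g k eps v) (u - v) <=
    lam eps * enorm (u - v) ^+ 2.
  move=> heps.
  have [L hL] := corrected_field_lipschitz f_smooth g_diff g_smooth b_gt0 g_diss kK heps.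
  exact: one_sided_lipschitzP hL.
(* All horizons reduce to bounding the exponent [lam eps * t] by a constant independent of [eps] and
   [t]. *)
have flow eps c t : 0 < eps <= eps0 -> 0 <= t -> lam eps * t <= c ->
    lipschitz_flow_at (corrected_field f g k eps) (expR c) t.
  move=> heps t_ge0 lc; apply: (@lipschitz_flow_atW _ _ _ (expR (lam eps * t))).
    by rewrite ler_expR.
  exact: lipschitz_flow (lamP eps heps) t_ge0.
split; [|split; [|split; [|split]]].
- have [C C_gt0 hC] :=
    error_estimate eps0 f_smooth g_diff g_smooth b_gt0 g_diss kK C0.
  exists C; split=> // eps heps t t_ge0.
  have [full _] := full_flow eps heps; have [sZ Z0] := full (x0 eps, y0 eps).
  have [sX X0] := X_sol eps heps.
  apply: (hC eps (fun t => Phi eps t (x0 eps, y0 eps))) => //; rewrite Z0//.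
  exact: prepared.
- move=> c c_gt0; exists (expR c); split; first exact: expR_gt0.
  move=> eps heps t t_ge0; rewrite /stability_horizon.
  case: ltP => [l_gt0|l_le0] ht; apply: flow => //.
    by move: ht; rewrite lee_fin ler_pdivlMr// mulrC.
  by rewrite (@le_trans _ _ 0)// ?(ltW c_gt0)// mulr_le0_ge0.
(* Up to time [a * eps ^ (- m)] the powers of [eps] cancel and the exponent stays below [a * c], for
   [zeta] and for the flow. *)
- move=> m c c_gt0 lam_le a a_gt0; exists (expR (a * c)).
  split; first exact: expR_gt0.
  move=> eps heps t /andP[t_ge0 t_le]; have /andP[eps_gt0 _] := heps.
  have lt_le : lam eps * t <= a * c.
    have p_gt0 : 0 < eps `^ m by exact: powR_gt0.
    rewrite (@le_trans _ _ (c * eps `^ m * t))//; first by rewrite ler_wpM2r// lam_le.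
    rewrite (@le_trans _ _ (c * eps `^ m * (a * eps `^ (- m))))//.
      by rewrite ler_wpM2l// mulr_ge0// ltW.
    by rewrite powRN [leLHS](_ : _ = a * c)//; field; rewrite gt_eqF.
  split; last exact: flow.
  rewrite zetaE// (le_trans (exp_primitive_le _ t_ge0))// ler_wpM2r// ler_expR.
  by rewrite ge_max lt_le andbT mulr_ge0// ltW.
- move=> eps heps l_le0 t t_ge0; rewrite zetaE//.
  rewrite (le_trans (exp_primitive_le _ t_ge0))//.
  have -> : Num.max 0 (lam eps * t) = 0 by apply/max_idPl; rewrite mulr_le0_ge0.
  by rewrite expR0 mul1r.
(* The summand 1 serves the bound by [t], and [c^-1] the bound by the integral over the
   half-line. *)
- move=> m c c_gt0 lam_le; exists (1 + c^-1).
  have ci_gt0 : 0 < c^-1 by rewrite invr_gt0.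
  split; first by rewrite addr_gt0.
  move=> eps heps t t_ge0; have /andP[eps_gt0 _] := heps.
  have p_gt0 : 0 < eps `^ m by exact: powR_gt0.
  have l_lt0 : lam eps < 0.
    by rewrite (le_lt_trans (lam_le eps heps))// mulNr oppr_lt0 mulr_gt0.
  rewrite zetaE// powRN; case: (leP t (eps `^ m)^-1) => _.
    rewrite (le_trans (exp_primitive_le _ t_ge0))//.
    have -> : Num.max 0 (lam eps * t) = 0.
      by apply/max_idPl; rewrite mulr_le0_ge0// ltW.
    by rewrite expR0 mul1r mulrDl mul1r lerDl mulr_ge0// ltW.
  rewrite (le_trans (exp_primitive_le_inv _ l_lt0))//.
  apply: (@le_trans _ _ (c^-1 * (eps `^ m)^-1)).
    rewrite -invfM lef_pV2 ?posrE ?mulr_gt0 ?oppr_gt0//.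
    by have := lam_le eps heps; rewrite mulNr; lra.
  by rewrite ler_wpM2r ?invr_ge0 ?(ltW p_gt0)// lerDr.
Qed.
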